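(* For generic $a,b,c$, and all $n \geq 3$, the natural morphism $\mathcal{K}_n \to \mathcal{H}_n$ is an isomorphism.
   Context: $K$ is a field of characteristic $0$, $a,b,c\in K$, $B_n$ is the braid group with Artin generators $s_1,\dots,s_{n-1}$, $H_n(a,b,c)=KB_n/((s_1-a)(s_1-b)(s_1-c))$. ''Generic'' means: $a,b,c$ and $(a-b)(a-c)(b-c)$ are nonzero and $H_3(a,b,c)$, $H_4(a,b,c)$ are split semisimple over $K$ (e.g. $a,b,c$ algebraically independent over $\mathbb{Q}$). $\mathcal{K}_n$ is the quotient of $H_n(a,b,c)$ by the two-sided ideal generated by $s_2^2 s_1 - s_1 s_2^2 - s_2 s_1^2 + s_1^2 s_2$. For $x\neq y$ in $\{a,b,c\}$ let $J_n(x,y)\subset KB_n$ be the two-sided ideal generated by $(s_1-x)(s_1-y)$; then $\mathcal{H}_n = KB_n/(J_n(a,b)\cap J_n(a,c)\cap J_n(b,c))$. The natural morphism is the surjection $s_i\mapsto s_i$. *)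

(* Defs.v *)
From HB Require Import structures.
From mathcomp Require Import all_boot all_order all_algebra.
From mathcomp Require Import finmap monalg.
From mathcomp Require Import boolp classical_sets.

Set Implicit Arguments.
Unset Strict Implicit.
Unset Printing Implicit Defensive.

Import GRing.Theory.
Local Open Scope quotient_scope.
Local Open Scope classical_set_scope.
Local Open Scope ring_scope.

(* A letter (x, false) stands for the generator x, (x, true) for its inverse. *)
Definition word (X : Type) := seq (X * bool).

Inductive pres_eqv (X : Type) (R : word X -> word X -> Prop) :
    word X -> word X -> Prop :=
| pres_refl u : pres_eqv R u u
| pres_sym u v : pres_eqv R u v -> pres_eqv R v u
| pres_trans v u w : pres_eqv R u v -> pres_eqv R v w -> pres_eqv R u w
| pres_cat u u' v v' :
    pres_eqv R u u' -> pres_eqv R v v' -> pres_eqv R (u ++ v) (u' ++ v')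
| pres_cancel x e : pres_eqv R [:: (x, e); (x, ~~ e)] [::]
| pres_rel u v : R u v -> pres_eqv R u v.

Section PresentedGroup.
Variables (X : choiceType) (R : word X -> word X -> Prop).

Definition pres_eqb (u v : word X) : bool := `[< pres_eqv R u v >].

Fact pres_eqb_refl : reflexive pres_eqb.
Proof. by move=> u; apply/asboolP; apply: pres_refl. Qed.

Fact pres_eqb_sym : symmetric pres_eqb.
Proof. by move=> u v; apply/asboolP/asboolP; apply: pres_sym. Qed.

Fact pres_eqb_trans : transitive pres_eqb.
Proof.
by move=> v u w /asboolP uv /asboolP vw; apply/asboolP; apply: pres_trans vw.
Qed.

Canonical pres_equiv :=
  EquivRel pres_eqb pres_eqb_refl pres_eqb_sym pres_eqb_trans.

Definition pres_group := {eq_quot pres_equiv}.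
HB.instance Definition _ := Choice.on pres_group.
HB.instance Definition _ := EqQuotient.on pres_group.

(* The operations of this file are locked: unification otherwise unfolds the
   iterated quotients, and rewriting in them does not terminate in practice. *)
Fact pres_key : unit. Proof. by []. Qed.

Definition word_class :=
  locked_with pres_key (fun u : word X => \pi_pres_group u).

Lemma word_classE u : word_class u = \pi_pres_group u.
Proof. by rewrite /word_class unlock. Qed.

Lemma pres_piP (u v : word X) :
  pres_eqv R u v <-> word_class u = word_class v.
Proof.
split=> [uv|/eqP]; first by apply/eqP; rewrite !word_classE piE; apply/asboolP.
by rewrite !word_classE piE => /asboolP.
Qed.

Lemma word_class_surj (g : pres_group) : exists u, g = word_class u.
Proof. by exists (repr g); rewrite !word_classE reprK. Qed.

Definition inv_word (u : word X) : word X := rev [seq (p.1, ~~ p.2) | p <- u].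

Definition pres_one : pres_group := word_class [::].
Definition pres_mul :=
  locked_with pres_key (fun g h : pres_group => word_class (repr g ++ repr h)).
Definition pres_inv :=
  locked_with pres_key (fun g : pres_group => word_class (inv_word (repr g))).

Lemma repr_pres_eqv u : pres_eqv R (repr (word_class u)) u.
Proof. by apply/pres_piP; rewrite !word_classE reprK. Qed.

Lemma pres_mulE u v :
  pres_mul (word_class u) (word_class v) = word_class (u ++ v).
Proof.
rewrite /pres_mul unlock; apply/pres_piP.
by apply: pres_cat; apply: repr_pres_eqv.
Qed.

Fact pres_mulA : associative pres_mul.
Proof.
move=> g h k; have [u ->] := word_class_surj g.
have [v ->] := word_class_surj h; have [w ->] := word_class_surj k.
by rewrite !pres_mulE catA.
Qed.

Fact pres_mul1 : left_id pres_one pres_mul.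
Proof.
move=> g; have [u ->] := word_class_surj g.
by rewrite /pres_one pres_mulE.
Qed.

Fact pres_mulr1 : right_id pres_one pres_mul.
Proof.
move=> g; have [u ->] := word_class_surj g.
by rewrite /pres_one pres_mulE cats0.
Qed.

Lemma inv_wordK : involutive inv_word.
Proof.
move=> u; rewrite /inv_word map_rev revK -map_comp map_id_in // => -[x e] _ /=.
by rewrite negbK.
Qed.

Lemma inv_word_mulV u : pres_eqv R (u ++ inv_word u) [::].
Proof.
elim: u => [|[x e] u IHu]; first exact: pres_refl.
rewrite /inv_word /= rev_cons -cats1 catA.
apply: (@pres_trans _ _ ([:: (x, e)] ++ [::] ++ [:: (x, ~~ e)])).
  apply: (@pres_cat _ _ [:: (x, e)]); first exact: pres_refl.
  by apply: pres_cat; [exact: IHu | exact: pres_refl].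
exact: pres_cancel.
Qed.

Lemma word_classK g : word_class (repr g) = g.
Proof. by rewrite word_classE reprK. Qed.

Fact pres_mulV : right_inverse pres_one pres_inv pres_mul.
Proof.
move=> g; rewrite /pres_inv unlock -{1}[g]word_classK pres_mulE.
by apply/pres_piP; apply: inv_word_mulV.
Qed.

Fact pres_mulVl : left_inverse pres_one pres_inv pres_mul.
Proof.
move=> g; rewrite /pres_inv unlock -{2}[g]word_classK pres_mulE.
by apply/pres_piP; rewrite -{2}[repr g]inv_wordK; apply: inv_word_mulV.
Qed.

HB.instance Definition _ := isGroup.Build pres_group
  pres_mulA pres_mul1 pres_mulr1 pres_mulVl pres_mulV.

Definition pres_gen (x : X) : pres_group := word_class [:: (x, false)].

End PresentedGroup.

(* The generators are indexed from 0: i : 'I_n.-1 stands for s_(i+1). *)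
Inductive braid_rel (n : nat) : word 'I_n.-1 -> word 'I_n.-1 -> Prop :=
| braid_rel3 (i j : 'I_n.-1) : j = i.+1 :> nat ->
    braid_rel [:: (i, false); (j, false); (i, false)]
              [:: (j, false); (i, false); (j, false)]
| braid_rel2 (i j : 'I_n.-1) : (i.+1 < j)%N ->
    braid_rel [:: (i, false); (j, false)] [:: (j, false); (i, false)].

Definition braid (n : nat) : groupType := pres_group (@braid_rel n).

Definition artin (n : nat) (i : 'I_n.-1) : braid n := pres_gen (@braid_rel n) i.

(* A K-algebra is a ring with a ring morphism from K to its center.  The
   algType of MathComp is not used because it excludes the zero ring, and the
   quotient of an algebra by an arbitrary two-sided ideal may vanish. *)
HB.mixin Record hasScalars (K : pzRingType) A of GRing.PzRing A := {
  scal : K -> A;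
  scalD : {morph scal : k l / k + l};
  scalM : {morph scal : k l / k * l};
  scal1 : scal 1 = 1;
  scalC : forall k x, scal k * x = x * scal k
}.

#[short(type="pzAlgType")]
HB.structure Definition PzAlgebra (K : pzRingType) :=
  {A of GRing.PzRing A & hasScalars K A}.

Definition is_alg_morphism (K : pzRingType) (A B : pzAlgType K)
    (f : {rmorphism A -> B}) : Prop :=
  forall k : K, f (scal k) = scal k.

Section GroupAlgebra.
Variables (K : fieldType) (G : groupType).

(* Finitely supported functions G -> K; <<c *g x>> is c times the element x. *)
Definition galg := {malg K[G]}.
HB.instance Definition _ := GRing.Lmodule.on galg.

Implicit Types g h : galg.

Fact galg_key : unit. Proof. by []. Qed.

Definition galg_mul := locked_with galg_key (fun g h : galg =>
  \sum_(x <- msupp g) \sum_(y <- msupp h)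
    << g@_x * h@_y *g (x * y)%g >> : galg).

Lemma galg_mul_def g h : galg_mul g h =
  \sum_(x <- msupp g) \sum_(y <- msupp h) << g@_x * h@_y *g (x * y)%g >>.
Proof. by rewrite /galg_mul unlock. Qed.

Lemma galg_mulw (d e : {fset G}) g h :
    (msupp g `<=` d)%fset -> (msupp h `<=` e)%fset ->
  galg_mul g h = \sum_(x <- d) \sum_(y <- e) << g@_x * h@_y *g (x * y)%g >>.
Proof.
move=> le_d le_e; rewrite galg_mul_def (big_fset_incl _ le_d) /=.
  apply/eq_bigr=> x _; apply/big_fset_incl => // y _ /mcoeff_outdom ->.
  by rewrite mulr0 monalgU0.
move=> x _ /mcoeff_outdom gx.
by rewrite big1 // => y _; rewrite gx mul0r monalgU0.
Qed.

Fact galg_mulDl : left_distributive galg_mul +%R.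
Proof.
move=> g1 g2 g.
rewrite (galg_mulw (msuppD_le _ _) (fsubset_refl _)).
rewrite (galg_mulw (fsubsetUl _ (msupp g2)) (fsubset_refl _)).
rewrite (galg_mulw (fsubsetUr (msupp g1) _) (fsubset_refl _)).
rewrite -big_split /=; apply/eq_bigr=> x _.
rewrite -big_split /=; apply/eq_bigr=> y _.
by rewrite mcoeffD mulrDl monalgUD.
Qed.

Fact galg_mulDr : right_distributive galg_mul +%R.
Proof.
move=> g g1 g2.
rewrite (galg_mulw (fsubset_refl _) (msuppD_le _ _)).
rewrite (galg_mulw (fsubset_refl _) (fsubsetUl _ (msupp g2))).
rewrite (galg_mulw (fsubset_refl _) (fsubsetUr (msupp g1) _)).
rewrite -big_split /=; apply/eq_bigr=> x _.
rewrite -big_split /=; apply/eq_bigr=> y _.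
by rewrite mcoeffD mulrDr monalgUD.
Qed.

Lemma galg_mul0 g : galg_mul 0 g = 0.
Proof. by rewrite galg_mul_def msupp0 big_seq_fset0. Qed.

Lemma galg_mulr0 g : galg_mul g 0 = 0.
Proof.
by rewrite galg_mul_def big1 // => x _; rewrite msupp0 big_seq_fset0.
Qed.

Lemma galg_mulUU c d (x y : G) :
  galg_mul << c *g x >> << d *g y >> = << c * d *g (x * y)%g >>.
Proof. by rewrite (galg_mulw msuppU_le msuppU_le) !big_seq_fset1 !mcoeffUU. Qed.

Lemma galg_ind (P : galg -> Prop) :
  P 0 -> (forall c x, P << c *g x >>) ->
  (forall g h, P g -> P h -> P (g + h)) ->
  forall g, P g.
Proof. by move=> P0 PU PD g; rewrite [g]monalgE; apply: big_ind. Qed.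

Fact galg_mulA : associative galg_mul.
Proof.
move=> g h k; elim/galg_ind: g => [|c x|g g' IH IH'].
- by rewrite !galg_mul0.
- elim/galg_ind: h => [|d y|h h' IH IH'].
  + by rewrite !(galg_mul0, galg_mulr0).
  + elim/galg_ind: k => [|e z|k k' IH IH'].
    * by rewrite !galg_mulr0.
    * by rewrite !galg_mulUU mulrA mulgA.
    * by rewrite !galg_mulDr IH IH'.
  + by rewrite !(galg_mulDl, galg_mulDr) IH IH'.
- by rewrite !galg_mulDl IH IH'.
Qed.

Definition galg_of := locked_with galg_key (fun x : G => << x >> : galg).

Lemma galg_ofE x : galg_of x = << x >>.
Proof. by rewrite /galg_of unlock. Qed.

Fact galg_mul1 : left_id (galg_of 1) galg_mul.
Proof.
move=> g; elim/galg_ind: g => [|c x|g h IHg IHh]; first exact: galg_mulr0.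
  by rewrite galg_ofE galg_mulUU mul1r mul1g.
by rewrite galg_mulDr IHg IHh.
Qed.

Fact galg_mulr1 : right_id (galg_of 1) galg_mul.
Proof.
move=> g; elim/galg_ind: g => [|c x|g h IHg IHh]; first exact: galg_mul0.
  by rewrite galg_ofE galg_mulUU mulr1 mulg1.
by rewrite galg_mulDl IHg IHh.
Qed.

HB.instance Definition _ := GRing.Zmodule_isPzRing.Build galg
  galg_mulA galg_mul1 galg_mulr1 galg_mulDl galg_mulDr.

Definition galg_scal :=
  locked_with galg_key (fun k : K => << k *g 1%g >> : galg).

Lemma galg_scalE k : galg_scal k = << k *g 1%g >>.
Proof. by rewrite /galg_scal unlock. Qed.

Fact galg_scalD : {morph galg_scal : k l / k + l}.
Proof. by move=> k l; rewrite !galg_scalE monalgUD. Qed.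

Fact galg_scalM : {morph galg_scal : k l / k * l}.
Proof. by move=> k l; rewrite !galg_scalE [RHS]galg_mulUU mulg1. Qed.

Fact galg_scalC (k : K) g : galg_scal k * g = g * galg_scal k.
Proof.
elim/galg_ind: g => [|c x|g h IHg IHh]; first by rewrite mul0r mulr0.
  by rewrite galg_scalE [LHS]galg_mulUU [RHS]galg_mulUU mulrC mul1g mulg1.
by rewrite mulrDl mulrDr IHg IHh.
Qed.

Fact galg_scal1 : galg_scal 1 = 1.
Proof. by rewrite galg_scalE -galg_ofE. Qed.

HB.instance Definition _ := hasScalars.Build K galg
  galg_scalD galg_scalM galg_scal1 galg_scalC.

Lemma galg_ofM (x y : G) : galg_of (x * y)%g = galg_of x * galg_of y.
Proof. by rewrite !galg_ofE [RHS]galg_mulUU mulr1. Qed.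

End GroupAlgebra.

Definition two_sided_ideal (A : pzRingType) (I : set A) : Prop :=
  [/\ I 0, forall x y, I x -> I y -> I (x + y),
      forall x y, I y -> I (x * y) & forall x y, I x -> I (x * y)].

Record ideal (A : pzRingType) :=
  Ideal { ideal_set :> A -> Prop; ideal_axiom : two_sided_ideal ideal_set }.

Fact ideal_gen_subproof (A : pzRingType) (S : set A) :
  two_sided_ideal (smallest (@two_sided_ideal A) S).
Proof.
split=> [I [[]]//|x y Ix Iy I [idI SI]|x y Iy I [idI SI]|x y Ix I [idI SI]];
  have [_ ID Il Ir] := idI.
- by apply: ID; [apply: Ix | apply: Iy].
- by apply: Il; apply: Iy.
- by apply: Ir; apply: Ix.
Qed.

Definition ideal_gen (A : pzRingType) (S : set A) : ideal A :=
  Ideal (ideal_gen_subproof S).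

Fact ideal_cap_subproof (A : pzRingType) (I J : ideal A) :
  two_sided_ideal [set x | I x /\ J x].
Proof.
have [I0 ID Il Ir] := ideal_axiom I; have [J0 JD Jl Jr] := ideal_axiom J.
by split=> // x y => [[Ix Jx] [Iy Jy]|[Iy Jy]|[Ix Jx]]; split; auto.
Qed.

Definition ideal_cap (A : pzRingType) (I J : ideal A) : ideal A :=
  Ideal (ideal_cap_subproof I J).

Section Quotient.
Variables (K : pzRingType) (A : pzAlgType K) (I : ideal A).

Lemma ideal0 : I 0. Proof. by case: (ideal_axiom I). Qed.

Lemma idealD x y : I x -> I y -> I (x + y).
Proof. by case: (ideal_axiom I) => _ ID _ _; apply: ID. Qed.

Lemma idealMl x y : I y -> I (x * y).
Proof. by case: (ideal_axiom I) => _ _ Il _; apply: Il. Qed.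

Lemma idealMr x y : I x -> I (x * y).
Proof. by case: (ideal_axiom I) => _ _ _ Ir; apply: Ir. Qed.

Lemma idealN x : I x -> I (- x).
Proof. by move=> Ix; rewrite -mulN1r; apply: idealMl. Qed.

Definition ideal_eqb (x y : A) : bool := `[< I (x - y) >].

Fact ideal_eqb_refl : reflexive ideal_eqb.
Proof. by move=> x; apply/asboolP; rewrite subrr; apply: ideal0. Qed.

Fact ideal_eqb_sym : symmetric ideal_eqb.
Proof.
by move=> x y; apply/asboolP/asboolP => /idealN; rewrite opprB.
Qed.

Fact ideal_eqb_trans : transitive ideal_eqb.
Proof.
move=> y x z /asboolP xy /asboolP yz; apply/asboolP.
by rewrite -(subrK y x) -addrA; apply: idealD.
Qed.

Canonical ideal_equiv :=
  EquivRel ideal_eqb ideal_eqb_refl ideal_eqb_sym ideal_eqb_trans.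

Definition quot := {eq_quot ideal_equiv}.
HB.instance Definition _ := Choice.on quot.
HB.instance Definition _ := EqQuotient.on quot.

Fact quot_key : unit. Proof. by []. Qed.

Definition proj := locked_with quot_key (fun x : A => \pi x : quot).

Lemma projE x : proj x = \pi x.
Proof. by rewrite /proj unlock. Qed.

Lemma proj_surj (q : quot) : exists x, q = proj x.
Proof. by exists (repr q); rewrite projE reprK. Qed.

Lemma projP (x y : A) : proj x = proj y <-> I (x - y).
Proof.
split=> [/eqP|Ixy]; first by rewrite !projE piE => /asboolP.
by apply/eqP; rewrite !projE piE; apply/asboolP.
Qed.

Lemma repr_proj x : I (repr (proj x) - x).
Proof. by apply/projP; rewrite projE reprK. Qed.

Definition quot_add :=
  locked_with quot_key (fun p q : quot => proj (repr p + repr q)).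
Definition quot_opp := locked_with quot_key (fun p : quot => proj (- repr p)).
Definition quot_mul :=
  locked_with quot_key (fun p q : quot => proj (repr p * repr q)).

Lemma quot_addE x y : quot_add (proj x) (proj y) = proj (x + y).
Proof.
rewrite /quot_add unlock; apply/projP; rewrite opprD addrACA.
by apply: idealD; apply: repr_proj.
Qed.

Lemma quot_oppE x : quot_opp (proj x) = proj (- x).
Proof.
rewrite /quot_opp unlock; apply/projP; rewrite -opprD.
by apply: idealN; apply: repr_proj.
Qed.

Lemma quot_mulE x y : quot_mul (proj x) (proj y) = proj (x * y).
Proof.
rewrite /quot_mul unlock; apply/projP; set x' := repr _; set y' := repr _.
have -> : x' * y' - x * y = x' * (y' - y) + (x' - x) * y.
  by rewrite mulrBr mulrBl addrA subrK.
by apply: idealD; [apply: idealMl | apply: idealMr]; apply: repr_proj.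
Qed.

Let quotE := (quot_addE, quot_oppE, quot_mulE).

Ltac lift_quot := repeat (let q := fresh "q" in let x := fresh "x" in
  move=> q; have [x {q}->] := proj_surj q).

Fact quot_addA : associative quot_add.
Proof. by lift_quot; rewrite !quotE addrA. Qed.
Fact quot_addC : commutative quot_add.
Proof. by lift_quot; rewrite !quotE addrC. Qed.
Fact quot_add0 : left_id (proj 0) quot_add.
Proof. by lift_quot; rewrite !quotE add0r. Qed.
Fact quot_addN : left_inverse (proj 0) quot_opp quot_add.
Proof. by lift_quot; rewrite !quotE addNr. Qed.

HB.instance Definition _ := GRing.isZmodule.Build quot
  quot_addA quot_addC quot_add0 quot_addN.

Lemma projD x y : proj (x + y) = proj x + proj y.
Proof. exact/esym/quot_addE. Qed.

Fact quot_mulA : associative quot_mul.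
Proof. by lift_quot; rewrite !quotE mulrA. Qed.
Fact quot_mul1 : left_id (proj 1) quot_mul.
Proof. by lift_quot; rewrite !quotE mul1r. Qed.
Fact quot_mulr1 : right_id (proj 1) quot_mul.
Proof. by lift_quot; rewrite !quotE mulr1. Qed.
Fact quot_mulDl : left_distributive quot_mul +%R.
Proof. by lift_quot; rewrite -projD !quotE mulrDl projD. Qed.
Fact quot_mulDr : right_distributive quot_mul +%R.
Proof. by lift_quot; rewrite -projD !quotE mulrDr projD. Qed.

HB.instance Definition _ := GRing.Zmodule_isPzRing.Build quot
  quot_mulA quot_mul1 quot_mulr1 quot_mulDl quot_mulDr.

Lemma projM x y : proj (x * y) = proj x * proj y.
Proof. exact/esym/quot_mulE. Qed.

HB.instance Definition _ := GRing.isNmodMorphism.Build A quot proj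
  (conj (erefl : proj 0 = 0) projD).
HB.instance Definition _ := GRing.isMonoidMorphism.Build A quot proj
  (conj (erefl : proj 1 = 1) projM).

Definition quot_scal (k : K) : quot := proj (scal k).

Fact quot_scalD : {morph quot_scal : k l / k + l}.
Proof. by move=> k l; rewrite /quot_scal scalD projD. Qed.
Fact quot_scalM : {morph quot_scal : k l / k * l}.
Proof. by move=> k l; rewrite /quot_scal scalM projM. Qed.
Fact quot_scal1 : quot_scal 1 = 1.
Proof. by rewrite /quot_scal scal1. Qed.
Fact quot_scalC k (q : quot) : quot_scal k * q = q * quot_scal k.
Proof. by have [x ->] := proj_surj q; rewrite -!projM scalC. Qed.

HB.instance Definition _ := hasScalars.Build K quot
  quot_scalD quot_scalM quot_scal1 quot_scalC.

End Quotient.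

(* A is isomorphic to a finite product of matrix algebras over K; the maps f i
   are the components of the isomorphism. *)
Definition split_semisimple (K : fieldType) (A : pzAlgType K) : Prop :=
  exists (r : nat) (d : 'I_r -> nat)
    (f : forall i : 'I_r, {rmorphism A -> 'M[K]_((d i).+1)}),
    (forall i (k : K), f i (scal k) = k%:M) /\
    (forall M : (forall i : 'I_r, 'M[K]_((d i).+1)),
        exists! x : A, forall i, f i x = M i).

Section CubicHecke.
Variables (K : fieldType) (n : nat).

Definition KB : pzAlgType K := galg K (braid n).

Definition s (i : 'I_n.-1) : KB := galg_of K (artin i).

(* The set below is the singleton {(s_1 - a)(s_1 - b)(s_1 - c)} as soon as
   n >= 2; it is empty for n <= 1, where there is no s_1.  The generating sets
   of calK_ideal and J are read in the same way. *)
Definition cubic_ideal (a b c : K) : ideal KB :=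
  ideal_gen [set x | exists2 s1 : 'I_n.-1, s1 = 0%N :> nat &
    x = (s s1 - scal a) * (s s1 - scal b) * (s s1 - scal c)].

Definition Hecke (a b c : K) : pzAlgType K := quot (cubic_ideal a b c).

Definition sHecke (a b c : K) (i : 'I_n.-1) : Hecke a b c :=
  proj (cubic_ideal a b c) (s i).

Definition calK_ideal (a b c : K) : ideal (Hecke a b c) :=
  ideal_gen [set x | exists i j : 'I_n.-1,
    let s1 := sHecke a b c i in let s2 := sHecke a b c j in
    [/\ i = 0%N :> nat, j = 1%N :> nat &
     x = s2 ^+ 2 * s1 - s1 * s2 ^+ 2 - s2 * s1 ^+ 2 + s1 ^+ 2 * s2]].

Definition calK (a b c : K) : pzAlgType K := quot (calK_ideal a b c).

Definition s_calK (a b c : K) (i : 'I_n.-1) : calK a b c :=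
  proj (calK_ideal a b c) (sHecke a b c i).

Definition J (x y : K) : ideal KB :=
  ideal_gen [set z | exists2 s1 : 'I_n.-1, s1 = 0%N :> nat &
    z = (s s1 - scal x) * (s s1 - scal y)].

Definition calH_ideal (a b c : K) : ideal KB :=
  ideal_cap (ideal_cap (J a b) (J a c)) (J b c).

Definition calH (a b c : K) : pzAlgType K := quot (calH_ideal a b c).

Definition s_calH (a b c : K) (i : 'I_n.-1) : calH a b c :=
  proj (calH_ideal a b c) (s i).

End CubicHecke.

Definition generic (K : fieldType) (a b c : K) : Prop :=
  [/\ [/\ a != 0, b != 0 & c != 0],
      (a - b) * (a - c) * (b - c) != 0,
      split_semisimple (Hecke 3 a b c) &
      split_semisimple (Hecke 4 a b c)].

(* Main.v *)
(* Write p_x(j) for the spectral projection of s_j to the eigenvalue x, and p, q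
   for those of s_1, s_2.  The relation defining calK says exactly that
   [p_x, q_y] = [p_y, q_x], which gives p_x q_y p_z = 0 for distinct x, y, z.
   With the braid relation, p_x q_y p_x q_y = mu p_x q_y, where
   mu = (x^2 - xy + y^2)/(x - y)^2.  It is nonzero since H_3 is semisimple, and
   different from 1 since xy is nonzero.  From these identities one derives
   p_x(i) p_y(j) p_z(k) = 0 for all i, j, k, first for three consecutive
   generators, then for s_1, s_2, s_4, then by conjugation; moreover the left
   ideal of the elements killed on the right by all p_z(k) is two-sided.
   Put v = p_a(1).  Since p_a(1) p_b(j) is killed by the ideal of p_c,
     s_j |-> [[a, (b - a) v p_b(j)], [0, s_j]]
   is a representation of the braid group over calK.  Its corner d_ab is a
   twisted derivation with v x = d_ab(x) + d_ac(x) + theta(x) v, theta being the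
   character s_j |-> a, and both theta and d_ab vanish on J(a, b).  So
   p_a(1) x = 0 in calK for x in the three ideals J; summing over a, x = 0. *)

From HB Require Import structures.
Require Import Defs.
From mathcomp Require Import all_boot all_algebra.
From mathcomp Require Import finmap monalg.
From mathcomp Require Import ring zify.
From mathcomp Require boolp.
Set Implicit Arguments.
Unset Strict Implicit.
Unset Printing Implicit Defensive.
Import GRing.Theory.
Local Open Scope ring_scope.

(** * Orthogonal idempotents *)

Definition distinct3 (T : eqType) (i j k : T) := [/\ i != j, i != k & j != k].

Ltac permute3 := solve
  [match goal with H : distinct3 _ _ _ |- _ =>
     case: H => ? ? ?; rewrite /distinct3; try split; by [|rewrite eq_sym] end].

Lemma third_index (i k : 'I_3) : i != k -> exists j, distinct3 i j k.
Proof.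
case: i k => [[|[|[|//]]] p] [[|[|[|//]]] q] // _;
  by [exists (@Ordinal 3 0 isT) | exists (@Ordinal 3 1 isT)
     | exists (@Ordinal 3 2 isT)].
Qed.

Lemma inverse_eq (B : pzRingType) (x y y' : B) :
  y' * x = 1 -> x * y = 1 -> y = y'.
Proof. by move=> y'x xy; rewrite -[y]mul1r -y'x -mulrA xy mulr1. Qed.

Section Scalars.
Variables (K : fieldType) (A : pzAlgType K).
Implicit Types (k l : K) (x y : A).

Lemma scal0 : scal 0 = 0 :> A.
Proof. by apply: (addrI (scal 0)); rewrite -scalD !addr0. Qed.

Lemma scalN k : scal (- k) = - scal k :> A.
Proof. by apply: (addrI (scal k)); rewrite -scalD !subrr scal0. Qed.

Lemma scalB k l : scal (k - l) = scal k - scal l :> A.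
Proof. by rewrite scalD scalN. Qed.

Lemma mulr_scalCA k x y : x * (scal k * y) = scal k * (x * y).
Proof. by rewrite mulrA -scalC mulrA. Qed.

Lemma scal_cancel k x y : k != 0 -> scal k * x = scal k * y -> x = y.
Proof.
move=> k0 /(congr1 (fun t => scal k^-1 * t)).
by rewrite !mulrA -!scalM mulVf // scal1 !mul1r.
Qed.

Lemma scal_eq0 k x : k != 0 -> scal k * x = 0 -> x = 0.
Proof. by move=> k0 kx; apply: (scal_cancel k0); rewrite kx mulr0. Qed.

Lemma scal_fix k x : k != 1 -> x = scal k * x -> x = 0.
Proof.
rewrite eq_sym -subr_eq0 => k1 kx; apply: (scal_eq0 k1).
by rewrite scalB scal1 mulrBl mul1r -kx subrr.
Qed.

End Scalars.

Section Frames.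
Variables (K : fieldType) (A : pzAlgType K).
Implicit Types (P Q R T : 'I_3 -> A) (x y z w : A).

(** A complete system of orthogonal idempotents. The sum is stated in every order of the indices, so
    that a product can be split along any of them. *)
Definition frame P :=
  (forall i j, P i * P j = if i == j then P i else 0) /\
  (forall i j k, distinct3 i j k -> P i + P j + P k = 1).

(* For the spectral idempotents of s_1 and s_2, this is equivalent to the
   defining relation of [calK]. *)
Definition linked P Q :=
  forall i j, P i * Q j - Q j * P i = P j * Q i - Q i * P j.

Variable mu : 'I_3 -> 'I_3 -> K.

(** The prefix [z] makes this a rewriting rule inside left-nested products; the same device recurs
    in the lemmas below. *)
Definition angled P Q := forall i j, i != j ->
  forall z, z * P i * Q j * P i * Q j = scal (mu i j) * (z * P i * Q j).

Definition adjacent P Q := [/\ linked P Q, angled P Q & angled Q P].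

Definition commuting P Q := forall i j, P i * Q j = Q j * P i.

Lemma linked_sym P Q : linked P Q -> linked Q P.
Proof. by move=> PQ i j; rewrite -[LHS]opprB -[RHS]opprB -PQ. Qed.

Lemma adjacent_sym P Q : adjacent P Q -> adjacent Q P.
Proof. by case=> /linked_sym. Qed.

Lemma commutingA P Q z i j :
  commuting P Q -> z * P i * Q j = z * Q j * P i.
Proof. by move=> PQ; rewrite -!mulrA PQ. Qed.

Lemma frame_idem P z i : frame P -> z * P i * P i = z * P i.
Proof. by case=> PP _; rewrite -mulrA PP eqxx. Qed.

Lemma frame_orth P z i j : frame P -> i != j -> z * P i * P j = 0.
Proof. by case=> PP _ /negPf ij; rewrite -mulrA PP ij mulr0. Qed.

Lemma frame_split P z i j k : frame P -> distinct3 i j k ->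
  z = z * P i + z * P j + z * P k.
Proof. by case=> _ sP /sP sP1; rewrite -!mulrDr sP1 mulr1. Qed.

Lemma linkedA P Q z i j : linked P Q ->
  z * P i * Q j = z * Q j * P i + (z * P j * Q i - z * Q i * P j).
Proof.
by move=> PQ; rewrite -!mulrA -mulrBr -PQ mulrBr [RHS]addrC subrK.
Qed.

(** Put P_i on the left and P_k on the right of [P_k, Q_j] = [P_j, Q_k]: orthogonality kills every
    term except P_i Q_j P_k. *)
Lemma triple0 P Q z i j k : frame P -> linked P Q ->
  distinct3 i j k -> z * P i * Q j * P k = 0.
Proof.
move=> fP PQ ijk; have [ij ik jk] := ijk.
have := congr1 (fun x => x * P k) (linkedA (z * P i) k j PQ).
rewrite /= (frame_orth _ fP ik) mulrDl mulrBl (frame_orth _ fP ij) !mul0r.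
by rewrite frame_idem // (frame_orth _ fP jk) subr0 addr0 => <-.
Qed.

Section Adjacent.
Variables P Q : 'I_3 -> A.
Hypotheses (fP : frame P) (fQ : frame Q) (PQ : adjacent P Q).

Lemma linkPQ : linked P Q. Proof. by case: PQ. Qed.

(* Hence the common annihilator of [P k] and [Q k] is stable under right
   multiplication by the [P i] and [Q i]. *)
Lemma annihilator_stable z i k : mu i k != 0 -> i != k ->
  z * P k = 0 -> z * Q k = 0 -> z * P i * Q k = 0.
Proof.
move=> mu0 ik zP zQ; have [j ijk] := third_index ik.
set u := z * P i * Q k.
have [ij _ jk] := ijk.
have uE : u = - (z * Q i * P k).
  by rewrite /u (linkedA _ _ _ linkPQ) zP zQ !mul0r !add0r.
have uPk : u * P k = u by rewrite uE mulNr frame_idem.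
have uQi : u * Q i = 0 by rewrite /u frame_orth // eq_sym.
have uPQ : u = - (z * P i * Q i * P k).
  rewrite -uPk; apply/eqP; rewrite -addr_eq0 -mulrDl.
  have -> : u + z * P i * Q i = z * P i - z * P i * Q j.
    rewrite {2}[z * P i](frame_split (z * P i) fQ ijk) -/u.
    by rewrite addrAC addrK addrC.
  rewrite mulrBl frame_orth // triple0 ?subr0 //; exact: linkPQ.
(* Since z Q_i P_k = - u, the angle relation reads mu u = u Q_i P_k, and u Q_i = 0 because u ends in
   Q_k. *)
apply: (scal_eq0 mu0); rewrite uE mulrN; have [_ _ ang] := PQ.
rewrite -(ang _ _ ik); apply/eqP; rewrite oppr_eq0; apply/eqP.
have -> : z * Q i * P k = - u by rewrite uE opprK.
by rewrite mulNr uQi oppr0 mul0r.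
Qed.

(** If both products starting with P vanish before w, [linked] gives Q_j P_i w = Q_i P_j w. With one
    more Q_j in front, the left side is unchanged and the right side becomes zero. *)
Lemma swap0 i j w : i != j ->
  (forall z, z * P i * Q j * w = 0) -> (forall z, z * P j * Q i * w = 0) ->
  forall z, z * Q j * P i * w = 0.
Proof.
move=> ij Pi Pj z.
have h z' : z' * Q j * P i * w = z' * Q i * P j * w.
  apply/eqP; rewrite -subr_eq0.
  have := congr1 (fun t => t * w) (linkedA z' i j linkPQ).
  rewrite /= !mulrDl mulNr Pi Pj add0r => /esym/eqP; by rewrite addrC.
have := h (z * Q j); rewrite frame_idem // => ->.
by rewrite (frame_orth _ fQ) 1?eq_sym // !mul0r.
Qed.

End Adjacent.

(** * Three consecutive generators *)

Section Chain.
Variables P Q R : 'I_3 -> A.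
Hypotheses (fP : frame P) (fQ : frame Q) (fR : frame R).
Hypotheses (PQ : adjacent P Q) (QR : adjacent Q R) (PR : commuting P R).
Hypothesis mu_neq0 : forall i j, i != j -> mu i j != 0.
Hypothesis mu_neq1 : forall i j, i != j -> mu i j != 1.

(** The vector y = z P_i Q_j R_k turns out to satisfy y Q_j = mu_jk y. As Q_j is idempotent and
    mu_jk is neither 0 nor 1, this forces y = 0. The obstruction to that equation is y Q_k R_j,
    which has to vanish. *)
Lemma chain0 z i j k : distinct3 i j k -> z * P i * Q j * R k = 0.
Proof.
move=> ijk; have [ij ik jk] := ijk.
have [lPQ aPQ aQP] := PQ; have [lQR aQR aRQ] := QR.
have lQP := linked_sym lPQ; have lRQ := linked_sym lQR.
have [mu0 mu1] := (mu_neq0 ij, mu_neq1 ij).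
have jik : distinct3 j i k by permute3.
have jki : distinct3 j k i by permute3.
have ikj : distinct3 i k j by permute3.
have kij : distinct3 k i j by permute3.
set y := z * P i * Q j * R k.
have yRk : y * R k = y by rewrite /y frame_idem.
have yPk : y * P k = 0.
  by rewrite /y -(commutingA _ _ _ PR) (triple0 _ fP lPQ ijk) mul0r.
have yQi : y * Q i = 0 by rewrite /y (triple0 _ fQ lQR jki).
have yPE : y = y * P i + y * P j.
  by rewrite {1}(frame_split y fP ijk) yPk addr0.
have yQE : y = y * Q j + y * Q k.
  by rewrite {1}(frame_split y fQ ijk) yQi add0r.
(* The vector [v] spans with [z * P i * Q j] the 2-dimensional type of the
   pair (i, j); it lies in the image of [Q i]. *)
pose v := z * P i * Q j * P i * Q i.
have vE : y * P i = scal (mu i j) * y + v * R k.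
  rewrite /y -(commutingA _ _ _ PR).
  rewrite [in LHS](frame_split (z * P i * Q j * P i) fQ ijk) -/v.
  by rewrite (triple0 _ fQ lQP jik) aPQ // addr0 addrC mulrDl -mulrA.
have vRQ : v * R k * Q j = 0 by rewrite /v (triple0 _ fQ lQR ikj).
have vRQR : v * R k * Q k * R j = 0.
  have := frame_split (v * R k) fQ ijk.
  rewrite vRQ addr0 => /(congr1 (fun t => t * R j)).
  rewrite mulrDl (frame_orth _ fR) 1?eq_sym // (triple0 _ fR lRQ kij) add0r.
  by move<-.
have yPQ : y * P i * Q j = scal (mu i j) * (y * Q j).
  by rewrite vE mulrDl vRQ addr0 mulrA.
have yQjPk : y * Q j * P k = 0.
  apply: (scal_eq0 mu0); rewrite mulrA -yPQ.
  by rewrite (triple0 _ fP lPQ ijk).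
have yQkPk : y * Q k * P k = 0.
  by have := yPk; rewrite {1}yQE mulrDl yQjPk add0r.
have yPQR : y * P i * Q k * R j = scal (mu i j) * (y * Q k * R j).
  by rewrite vE !mulrDl vRQR addr0 !mulrA.
(* Split along P. The P_k part vanishes by [yQkPk], the P_j part by [triple0], and the P_i part
   equals mu_ij times itself. *)
have yQR : y * Q k * R j = 0.
  rewrite (frame_split (y * Q k * R j) fP ijk).
  have -> : y * Q k * R j * P k = 0.
    by rewrite -(commutingA _ _ _ PR) yQkPk mul0r.
  have -> : y * Q k * R j * P j = 0.
    apply: (scal_eq0 mu0); rewrite mulrA -yPQR -(commutingA _ _ _ PR).
    by rewrite (triple0 _ fP lPQ ikj) mul0r.
  have -> : y * Q k * R j * P i = 0.
    apply: (scal_fix mu1).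
    have h : y * P j * Q k * R j * P i = 0.
      by rewrite -(commutingA _ _ _ PR) (triple0 _ fP lPQ jki) mul0r.
    have {1}-> : y * Q k * R j = y * P i * Q k * R j + y * P j * Q k * R j.
      by rewrite -!mulrDl -yPE.
    by rewrite mulrDl h addr0 yPQR -!mulrA.
  by rewrite !addr0.
have yQjRj : y * Q j * R j = 0.
  have := congr1 (fun t => t * R j) yQE; rewrite /= mulrDl yQR addr0.
  by rewrite -{1}yRk (frame_orth _ fR) 1?eq_sym // => <-.
(* Along R only the R_k part of y Q_j survives, and it is given by the angle relation of Q and R. *)
have yQj : y * Q j = scal (mu j k) * y.
  rewrite {1}(frame_split (y * Q j) fR ijk) yQjRj addr0.
  have -> : y * Q j * R i = 0 by rewrite /y (triple0 _ fR lRQ) //; permute3.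
  by rewrite add0r /y aQR.
apply: (scal_eq0 (mu_neq0 jk)); rewrite -yQj.
apply: (scal_fix (mu_neq1 jk)).
have <- : y * Q j * Q j = y * Q j by rewrite frame_idem.
by rewrite {1}yQj -mulrA frame_idem.
Qed.

End Chain.
End Frames.

(** * Spectral projections *)

Section Spectrum.
Variables (K : fieldType) (A : pzAlgType K) (e : 'I_3 -> K).
Hypothesis e_inj : injective e.
Implicit Types (s t w : A).

Definition spectral s :=
  forall i j k, distinct3 i j k ->
    (s - scal (e i)) * (s - scal (e j)) * (s - scal (e k)) = 0.

(** Lagrange interpolation at the eigenvalues. Addition in ['I_3] is modulo 3, so i + 1 and i + 2
    are the other two indices. *)
Definition eigenproj s i := scal ((e i - e (i + 1)) * (e i - e (i + 2)))^-1 *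
  ((s - scal (e (i + 1))) * (s - scal (e (i + 2)))).

Lemma quadE s (k l : K) :
  (s - scal k) * (s - scal l) = s * s - scal (k + l) * s + scal (k * l).
Proof.
rewrite mulrBl !mulrBr -scalM -scalC scalD mulrDl !opprD opprK !addrA.
by congr (_ + _); rewrite addrAC.
Qed.

Lemma eigenprojE s i j k : distinct3 i j k -> eigenproj s i =
  scal ((e i - e j) * (e i - e k))^-1 *
  (s * s - scal (e j + e k) * s + scal (e j * e k)).
Proof.
move=> [ij ik jk]; rewrite /eigenproj quadE.
have [[-> ->]//|[-> ->]] :
    (j = i + 1 /\ k = i + 2) \/ (k = i + 1 /\ j = i + 2).
  by move: i j k ij ik jk => [[|[|[|//]]] p] [[|[|[|//]]] q]
    [[|[|[|//]]] r] // _ _ _;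
    solve [left; split; exact: val_inj | right; split; exact: val_inj].
by rewrite [e (i + 2) + _]addrC [e (i + 2) * _]mulrC [X in scal X^-1]mulrC.
Qed.

Lemma subr_e i j : i != j -> e i - e j != 0.
Proof. by move=> ij; rewrite subr_eq0 (inj_eq e_inj). Qed.

Lemma eigenproj_eig s i : spectral s ->
  s * eigenproj s i = scal (e i) * eigenproj s i.
Proof.
move=> ss; have ijk : distinct3 i (i + 1) (i + 2) by case: i => [[|[|[|//]]] ?].
apply/eqP; rewrite -subr_eq0 -mulrBl /eigenproj mulr_scalCA (mulrA (s - _)).
by rewrite ss // mulr0.
Qed.

Lemma eigenproj_frame s : spectral s -> frame (eigenproj s).
Proof.
move=> ss; split=> [i j|i j k ijk]; last first.
  have [ij ik jk] := ijk.
  have jik : distinct3 j i k by permute3.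
  have kij : distinct3 k i j by permute3.
  rewrite (eigenprojE _ ijk) (eigenprojE _ jik) (eigenprojE _ kij).
  have expand (d u v : K) : scal d * (s * s - scal u * s + scal v) =
      scal d * (s * s) - scal (d * u) * s + scal (d * v).
    by rewrite mulrDr mulrBr (mulrA (scal d) (scal u)) -!scalM.
  have nz := subr_e.
  rewrite !expand; set di := _^-1; set dj := _^-1; set dk := _^-1.
  (* Collect the coefficients of s^2, s and 1: the three Lagrange polynomials add up to the constant
     1. *)
  rewrite [LHS](AC (3*3*3) ((1*4*7)*(2*5*8)*(3*6*9))) /=.
  rewrite -!opprD -!mulrDl -!scalD.
  have -> : di + dj + dk = 0 by rewrite /di /dj /dk; field; rewrite ?nz // eq_sym.
  have -> : di * (e j + e k) + dj * (e i + e k) + dk * (e i + e j) = 0.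
    by rewrite /di /dj /dk; field; rewrite ?nz // eq_sym.
  have -> : di * (e j * e k) + dj * (e i * e k) + dk * (e i * e j) = 1.
    by rewrite /di /dj /dk; field; rewrite ?nz // eq_sym.
  by rewrite scal0 !mul0r subr0 add0r scal1.
have ev x : (s - scal x) * eigenproj s j = scal (e j - x) * eigenproj s j.
  by rewrite mulrBl eigenproj_eig // -mulrBl -scalB.
(* On a Q where s acts as x, the i-th projection acts as the i-th Lagrange polynomial at x; for x =
   e_j this value is 1 or 0. *)
have evQ Q x : (forall u, (s - scal u) * Q = scal (x - u) * Q) ->
    eigenproj s i * Q = scal (((e i - e (i + 1)) * (e i - e (i + 2)))^-1 *
      (x - e (i + 2)) * (x - e (i + 1))) * Q.
  by move=> Qx; rewrite /eigenproj -!mulrA Qx mulr_scalCA Qx !mulrA -!scalM.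
rewrite (evQ _ (e j)) // {evQ ev}.
have [i1 i2] : i != i + 1 /\ i != i + 2 by case: i => [[|[|[|//]]] ?].
case: eqP => [<-|/eqP ij].
  rewrite [X in scal X](_ : _ = 1) ?scal1 ?mul1r //.
  by field; rewrite !subr_e.
have [->|->] : j = i + 1 \/ j = i + 2.
  by move: i j ij {i1 i2} => [[|[|[|//]]] p] [[|[|[|//]]] q] // _;
    solve [left; exact: val_inj | right; exact: val_inj].
- by rewrite subrr mulr0 scal0 mul0r.
- by rewrite subrr mulr0 mul0r scal0 mul0r.
Qed.

Lemma eigenproj_sum s i j k : spectral s -> distinct3 i j k ->
  s = scal (e i) * eigenproj s i + scal (e j) * eigenproj s j
    + scal (e k) * eigenproj s k.
Proof.
move=> ss ijk; rewrite -!(eigenproj_eig _ ss) -!mulrDr.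
by have [_ ->] := eigenproj_frame ss; rewrite ?mulr1.
Qed.

Lemma eigenproj_intertwine s t w i :
  s * w = w * t -> eigenproj s i * w = w * eigenproj t i.
Proof.
move=> sw; rewrite /eigenproj mulr_scalCA -!mulrA; congr (_ * _).
have sub k : (s - scal k) * w = w * (t - scal k).
  by rewrite mulrBl mulrBr sw scalC.
by rewrite sub !mulrA sub.
Qed.

(** The bracket is bilinear and kills scalars, so [p_i, q_j] is a combination of [s^2, t^2],
    [s^2, t], [s, t^2] and [s, t]. The hypothesis says [s^2, t] = [s, t^2], which makes the
    coefficients symmetric in i and j. *)
Lemma eigenproj_linked s t :
  t * t * s - s * (t * t) - t * (s * s) + s * s * t = 0 ->
  linked (eigenproj s) (eigenproj t).
Proof.
move=> r; pose br (x y : A) := x * y - y * x.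
suff sym i j : br (eigenproj s i) (eigenproj t j) = br (eigenproj s j) (eigenproj t i).
  by move=> i j; exact: sym.
have brDl x y z : br (x + y) z = br x z + br y z.
  by rewrite /br mulrDl mulrDr opprD addrACA.
have brDr x y z : br x (y + z) = br x y + br x z.
  by rewrite /br mulrDl mulrDr opprD addrACA.
have brZl k x y : br (scal k * x) y = scal k * br x y.
  by rewrite /br mulr_scalCA -mulrA -mulrBr.
have brZr k x y : br x (scal k * y) = scal k * br x y.
  by rewrite /br mulr_scalCA -mulrA -mulrBr.
have brSl k x : br (scal k) x = 0 by rewrite /br scalC subrr.
have brSr k x : br x (scal k) = 0 by rewrite /br scalC subrr.
have brr : br s (t * t) = br (s * s) t.
  apply/eqP; rewrite eq_sym -subr_eq0 /br opprB -r; apply/eqP.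
  by rewrite [LHS](AC (2*2) (3*4*2*1)).
pose c l := - (e (l + 1) + e (l + 2)).
have ex u l : eigenproj u l = scal ((e l - e (l + 1)) * (e l - e (l + 2)))^-1 *
    (u * u + (scal (c l) * u + scal (e (l + 1) * e (l + 2)))).
  by rewrite /eigenproj quadE scalN mulNr -addrA.
rewrite !ex !(brZl, brZr, brDl, brDr, brSl, brSr, addr0) brr.
rewrite [LHS]mulrA [RHS]mulrA -!scalM.
congr (scal _ * _); first by rewrite mulrC.
move: (br (s * s) (t * t)) (br (s * s) t) (br s t) => x y w.
rewrite !mulrDr !mulrA -!scalM [c j * _]mulrC !addrA.
by congr (_ + _); rewrite addrAC.
Qed.

(** Compute v s t for v = z P_i Q_j in two ways: with the eigenvalues of s on P_i, P_j and of t on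
    Q_i, Q_j, and by moving Q_j through s t, which turns it into P_j. The comparison isolates v P_i
    Q_j. *)
Lemma eigenproj_angled s t : spectral s -> spectral t -> s * t * s = t * s * t ->
  linked (eigenproj s) (eigenproj t) ->
  angled (fun i j => (e i ^+ 2 - e i * e j + e j ^+ 2) / (e i - e j) ^+ 2)
     (eigenproj s) (eigenproj t).
Proof.
move=> ss st sts lPQ i j ij z; have [k ikj] := third_index ij.
have [fP fQ] := (eigenproj_frame ss, eigenproj_frame st).
have ijk : distinct3 i j k by permute3.
have jik : distinct3 j i k by permute3.
have [_ _ jk] := ijk.
set P := eigenproj s in lPQ fP *; set Q := eigenproj t in lPQ fQ *.
set v := z * P i * Q j; pose D := e i - e j.
have actP x l : x * P l * s = scal (e l) * (x * P l).
  rewrite -mulrA /P (eigenproj_intertwine l (erefl (s * s))).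
  by rewrite eigenproj_eig // mulr_scalCA.
have actQ x l : x * Q l * t = scal (e l) * (x * Q l).
  rewrite -mulrA /Q (eigenproj_intertwine l (erefl (t * t))).
  by rewrite eigenproj_eig // mulr_scalCA.
have QP : Q j * (s * t) = s * t * P j.
  by apply: eigenproj_intertwine; rewrite mulrA -sts.
clearbody P Q.
have vP : v = v * P i + v * P j.
  by rewrite {1}(frame_split v fP ijk) (triple0 _ fP lPQ ijk) addr0.
have vPQ : v * P i = v * P i * Q i + v * P i * Q j.
  rewrite {1}(frame_split (v * P i) fQ ijk).
  by rewrite (triple0 _ fQ (linked_sym lPQ) jik) addr0.
have two x y : scal (e i) * x + scal (e j) * y = scal (e j) * (x + y) + scal D * x.
  by rewrite /D scalB mulrBl mulrDr [RHS]addrC addrA subrK.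
have vs : v * s = scal (e j) * v + scal D * (v * P i).
  by rewrite {1}vP mulrDl !actP two -vP.
have vPt : v * P i * t = scal (e i) * (v * P i) - scal D * (v * P i * Q j).
  rewrite {1}vPQ mulrDl !actQ; apply/eqP; rewrite eq_sym subr_eq {1}vPQ mulrDr.
  by rewrite -addrA -mulrDl -scalD /D (addrC (e j)) subrK.
have PQP : z * P i * Q i * P j = - (v * P j).
  have := congr1 (fun x => x * P j) (frame_split (z * P i) fQ ijk).
  rewrite /= !mulrDl (triple0 _ fP lPQ ikj) (frame_orth _ fP ij) addr0 -/v.
  by move/esym/eqP; rewrite addr_eq0 => /eqP.
have PtP : z * P i * t * P j = - (scal D * (v * P j)).
  have -> : z * P i * t = scal (e i) * (z * P i * Q i) + scal (e j) * v
                       + scal (e k) * (z * P i * Q k).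
    by rewrite {1}(frame_split (z * P i) fQ ijk) 2!mulrDl !actQ.
  rewrite 2!mulrDl -3!(mulrA (scal _)) (triple0 _ fP lPQ ikj) mulr0 addr0 PQP.
  by rewrite mulrN /D scalB mulrBl opprB addrC.
have D0 : D != 0 by exact: subr_e.
apply: (@scal_cancel _ _ (D ^+ 2)); first by rewrite expf_neq0.
set w := v * P i * Q j in vPt *.
have vst : v * (s * t) = scal (e i) * (z * P i * t * P j).
  rewrite /v -!(mulrA _ (Q j)) QP !mulrA.
  by rewrite actP -!mulrA.
have vt : v * t = scal (e j) * v by rewrite /v actQ.
move: vst; rewrite PtP mulrA vs mulrDl -mulrA vt -mulrA vPt mulrBr.
rewrite [in LHS]mulrA [scal D * (scal D * w)]mulrA.
rewrite [scal D * (scal (e i) * _)]mulrA -!scalM addrA => vst.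
(* The two values of v s t are equated; as v P_i + v P_j = v, the right side is (e_j^2 + D e_i)
   v. *)
have -> : scal (D ^+ 2) * w = scal (e j * e j) * v
    + scal (D * e i) * (v * P i) + scal (e i) * (scal D * (v * P j)).
  by apply/eqP; rewrite -subr_eq0 opprD addrA -mulrN -vst addrA subrK subrr.
have -> : v * P j = v - v * P i by rewrite {2}vP addrC addKr.
rewrite [scal (e i) * _]mulrA -scalM mulrBr [e i * D]mulrC -addrA.
rewrite [X in _ + X]addrC subrK -mulrDl [RHS]mulrA -scalM -scalD.
by congr (scal _ * _); rewrite /D; field.
Qed.

End Spectrum.

(** * Four consecutive generators *)

Section FourGenerators.
Variables (K : fieldType) (A : pzAlgType K) (mu : 'I_3 -> 'I_3 -> K).
Variables (P Q R T : 'I_3 -> A) (e : 'I_3 -> K) (r t : A).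
Hypotheses (fP : frame P) (fQ : frame Q) (fR : frame R) (fT : frame T).
Hypotheses (PQ : adjacent mu P Q) (QR : adjacent mu Q R) (RT : adjacent mu R T).
Hypotheses (PR : commuting P R) (QT : commuting Q T).
Hypothesis mu_neq0 : forall i j, i != j -> mu i j != 0.
Hypothesis mu_neq1 : forall i j, i != j -> mu i j != 1.
Hypothesis e_neq0 : forall i, e i != 0.
Hypothesis Rr : forall z i, z * R i * r = scal (e i) * (z * R i).
Hypotheses (Pt : forall i, P i * t = t * P i) (Qt : forall i, Q i * t = t * Q i).
Hypothesis RtrT : forall i, R i * (t * r) = t * r * T i.
Hypothesis t_reg : forall x, t * x = 0 -> x = 0.

(** Put v = P_i Q_j. It commutes with t and v R_k = 0, so t v r T_k = v R_k t r = 0 and v r T_k = 0.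
    This is a linear relation between v R_i T_k and v R_j T_k; the first is shown to vanish by
    splitting along Q, so both do, and so does v T_k. *)
Lemma four0 z i j k : distinct3 i j k -> z * P i * Q j * T k = 0.
Proof.
move=> ijk; have [ij ik jk] := ijk.
have jik : distinct3 j i k by permute3.
have jki : distinct3 j k i by permute3.
have PQR x l m n : distinct3 l m n -> x * P l * Q m * R n = 0.
  exact: (chain0 fP fQ fR PQ QR PR).
have QRT x l m n : distinct3 l m n -> x * Q l * R m * T n = 0.
  exact: (chain0 fQ fR fT QR RT QT).
have RQT x : x * R j * Q i * T k = 0.
  by apply: (swap0 fR QR) => // y; apply: QRT.
(* The prefix [z] need not commute with [t], so it is removed first. *)
suff: P i * Q j * T k = 0 by rewrite -!mulrA => ->; rewrite mulr0.
set v := P i * Q j.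
have vR : v * R k = 0 by rewrite /v -[P i]mul1r PQR.
have tv : t * v = v * t by rewrite /v mulrA -Pt -!mulrA Qt.
have vRQ : v * R i * Q k = 0.
  by rewrite /v (triple0 _ fQ _ jik) //; case: QR.
clearbody v.
have vrT : v * r * T k = 0.
  apply: t_reg; rewrite !mulrA tv.
  by rewrite -!mulrA [t * _]mulrA -RtrT mulrA vR mul0r.
have {}vrT : scal (e i) * (v * R i * T k) + scal (e j) * (v * R j * T k) = 0.
  rewrite -vrT {3}(frame_split v fR ijk) vR addr0 mulrDl !Rr mulrDl.
  by rewrite !mulrA.
have vRQT : v * R i * Q i * T k = 0.
  apply: (scal_eq0 (e_neq0 i)).
  have := congr1 (fun x => x * Q i) vrT.
  rewrite /= mulrDl mul0r -!(mulrA (scal _)) -!(commutingA _ _ _ QT).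
  by rewrite RQT mulr0 addr0.
have vRT : v * R i * T k = 0.
  rewrite (frame_split (v * R i) fQ ijk) !mulrDl vRQT add0r.
  have -> : v * R i * Q j * T k = 0.
    by apply: (swap0 fR QR); [rewrite eq_sym | |] => // y; apply: QRT.
  by rewrite vRQ mul0r addr0.
rewrite (frame_split v fR ijk) vR addr0 mulrDl vRT add0r.
apply: (scal_eq0 (e_neq0 j)).
by have := vrT; rewrite vRT mulr0 add0r.
Qed.

End FourGenerators.

(** * Triangular matrices *)

HB.instance Definition _ (K : fieldType) (A : pzAlgType K) :=
  GRing.isNmodMorphism.Build K A (@scal K A) (conj (@scal0 K A) (@scalD K A)).
HB.instance Definition _ (K : fieldType) (A : pzAlgType K) :=
  GRing.isMonoidMorphism.Build K A (@scal K A) (conj (@scal1 K A) (@scalM K A)).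

Section Triangular.
Variables (K : fieldType) (A : pzAlgType K).
Implicit Types (k l : K) (u w x y : A).

Definition tri k u x : 'M[A]_2 :=
  \matrix_(i, j) if i == 0 then (if j == 0 then scal k else u)
                 else (if j == 0 then 0 else x).

Lemma tri_eq k u x (M : 'M[A]_2) :
  M 0 0 = scal k -> M 0 1 = u -> M 1 0 = 0 -> M 1 1 = x -> M = tri k u x.
Proof.
move=> M00 M01 M10 M11; apply/matrixP => i j; rewrite mxE.
by case: i j => [[|[|//]] p] [[|[|//]] q] /=;
  rewrite -?M00 -?M01 -?M10 -?M11; congr (M _ _); apply: val_inj.
Qed.

Lemma tri_corner k u x : (tri k u x) 0 1 = u. Proof. by rewrite mxE. Qed.

Lemma triM k l u w x y :
  tri k u x * tri l w y = tri (k * l) (scal k * w + u * y) (x * y).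
Proof.
by apply: tri_eq; rewrite !mxE !big_ord_recl big_ord0 !mxE /=
  ?mul0r ?mulr0 ?add0r ?addr0 ?scalM.
Qed.

Lemma triD k l u w x y : tri k u x + tri l w y = tri (k + l) (u + w) (x + y).
Proof. by apply: tri_eq; rewrite !mxE /= ?addr0 ?scalD. Qed.

Lemma tri_scalar k : (scal k : A)%:M = tri k 0 (scal k).
Proof. by apply: tri_eq; rewrite mxE. Qed.

Lemma tri_scalarC k (M : 'M[A]_2) : (scal k)%:M * M = M * (scal k)%:M.
Proof.
apply/matrixP => i j; rewrite !mxE !big_ord_recl !big_ord0 !mxE.
by case: i j => [[|[|//]] p] [[|[|//]] q];
  rewrite /= ?mulr1n ?mulr0n ?mul0r ?mulr0 ?addr0 ?add0r scalC;
  congr (M _ _ * _); apply: val_inj.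
Qed.

(* The conjugate of diag(k, x) by the unipotent matrix with corner [w]. *)
Definition tri_conj w k x := tri k (w * x - scal k * w) x.

Lemma tri_conjM w k l x y :
  tri_conj w k x * tri_conj w l y = tri_conj w (k * l) (x * y).
Proof.
rewrite /tri_conj triM; congr tri.
by rewrite mulrBr mulrBl !mulrA scalM [LHS]addrC addrA subrK.
Qed.

(** Functional calculus: for the spectral projections of s this is f(s), [f] listing the values at
    the three eigenvalues. *)
Definition combine (P : 'I_3 -> A) (f : 'I_3 -> K) := \sum_x scal (f x) * P x.

Section GenMatrix.
Variable P : 'I_3 -> A.
Hypothesis fP : frame P.

Lemma frame_combine z f i : z * P i * combine P f = scal (f i) * (z * P i).
Proof.
rewrite /combine mulr_sumr (bigD1 i) //= mulr_scalCA frame_idem // big1 ?addr0 //.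
by move=> j ji; rewrite mulr_scalCA frame_orth ?mulr0 1?eq_sym.
Qed.

Lemma combineM f g : combine P f * combine P g = combine P (fun i => f i * g i).
Proof.
rewrite {1}/combine mulr_suml; apply: eq_bigr => i _.
by rewrite -[P i]mul1r -mulrA frame_combine mulrA -scalM.
Qed.

Lemma combine_cst k : combine P (fun=> k) = scal k.
Proof.
have [_ P1] := fP; rewrite /combine -mulr_sumr !big_ord_recl big_ord0 addr0.
by rewrite addrA P1 ?mulr1.
Qed.

(* For f = e this is the action of s = combine P e on the extension, by the
   right ideal of the vectors v P_b x, of the character s_i |-> e a. *)
Definition gen_mx a b v f := tri (f a) (scal (f b - f a) * (v * P b)) (combine P f).

Lemma gen_mxM a b v f g :
  gen_mx a b v f * gen_mx a b v g = gen_mx a b v (fun i => f i * g i).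
Proof.
rewrite /gen_mx triM combineM -[X in _ + X]mulrA frame_combine !(mulrA (scal _) (scal _)).
rewrite -!scalM -mulrDl -scalD.
by congr (tri _ (scal _ * _) _); ring.
Qed.

Lemma gen_mx_cst a b v k : gen_mx a b v (fun=> k) = tri k 0 (scal k).
Proof. by rewrite /gen_mx subrr scal0 mul0r combine_cst. Qed.

(** Since w = w P_a + v P_b, the P_a part cancels in the corner of [tri_conj] and the v P_b part
    gives the corner of [gen_mx]. The same w serves every f. *)
Lemma gen_mx_conj a b c v w f : distinct3 a b c -> w * P b = v * P b -> w * P c = 0 ->
  gen_mx a b v f = tri_conj w (f a) (combine P f).
Proof.
move=> abc wb wc; rewrite /gen_mx /tri_conj; congr tri.
have wE : w = w * P a + v * P b by rewrite {1}(frame_split w fP abc) wb wc addr0.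
rewrite [in RHS]wE mulrDl !frame_combine mulrDr opprD addrACA subrr add0r.
by rewrite -mulrBl -scalB.
Qed.

(** The identity v x = d_ab(x) + d_ac(x) + theta(x) v for x = f(s). *)
Lemma combine_corner a b c v f : distinct3 a b c ->
  v * combine P f = scal (f b - f a) * (v * P b) + scal (f c - f a) * (v * P c)
                    + scal (f a) * v.
Proof.
move=> abc; have vE := frame_split v fP abc.
rewrite [in LHS]vE !mulrDl !frame_combine // [X in _ = _ + scal _ * X]vE !mulrDr.
rewrite !scalB !mulrBl.
set A1 := scal _ * _; set B1 := scal _ * _; set C1 := scal _ * _.
set B2 := scal (f a) * _; set C2 := scal (f a) * _.
by rewrite [RHS](AC ((2*2)*3) ((5)*(1*(2*6))*(3*(4*7)))) /= !addNr !addr0.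
Qed.

End GenMatrix.

Section PairMatrix.
Variables (P Q : 'I_3 -> A) (a b c : 'I_3) (v : A).
Hypotheses (fP : frame P) (fQ : frame Q) (abc : distinct3 a b c).
Hypotheses (vPQ : v * P b * Q c = 0) (vPQ' : v * P c * Q b = 0).

(* Conjugation by the unipotent matrix with corner [w] diagonalises the
   matrices attached to [P] and to [Q] simultaneously, so that relations
   between the generators pass to their matrices. *)
Definition splitting w :=
  [/\ w * P b = v * P b, w * P c = 0, w * Q b = v * Q b & w * Q c = 0].

Lemma splitting_commuting : commuting P Q -> exists w, splitting w.
Proof.
(* The witness is v (1 - (1 - P_b)(1 - Q_b)), that is, v times the join of two commuting
   idempotents. *)
move=> PQ; have [ab ac bc] := abc; exists (v * P b + v * Q b - v * P b * Q b).
have QP i j z : z * Q i * P j = z * P j * Q i by rewrite (commutingA _ _ _ PQ).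
split; rewrite !(mulrDl, mulNr).
- by rewrite !QP !frame_idem // addrK.
- by rewrite !QP !(frame_orth _ fP bc) mul0r subr0 add0r vPQ'.
- by rewrite !frame_idem // addrAC subrr add0r.
- by rewrite vPQ !(frame_orth _ fQ bc) subr0 addr0.
Qed.

Lemma splitting_adjacent mu : adjacent mu P Q -> mu a b != 0 -> exists w, splitting w.
Proof.
move=> [lPQ aPQ _] mu0; have [ab ac bc] := abc.
have bac : distinct3 b a c by permute3.
(* The second term is killed by P_b and P_c, and the factor mu_ab^-1 makes its product with Q_b
   equal to v P_a Q_b, by the angle relation. *)
exists (v * P b + scal (mu a b)^-1 * (v * P a * Q b * P a)).
split; rewrite mulrDl -(mulrA (scal _)).
- by rewrite frame_idem // frame_orth // mulr0 addr0.
- by rewrite !frame_orth // mulr0 addr0.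
- rewrite aPQ // mulrA -scalM mulVf // scal1 mul1r.
  by rewrite [in RHS](frame_split v fP abc) 2!mulrDl vPQ' addr0 addrC.
- by rewrite vPQ (triple0 _ fQ (linked_sym lPQ)) // mulr0 addr0.
Qed.

End PairMatrix.
End Triangular.

(** * Universal property of the group algebra of the braid group *)

Lemma braid_mulE n (g h : braid n) : (g * h)%g = pres_mul g h.
Proof. by []. Qed.

Lemma braid_class_mul n (u v : word 'I_n.-1) (g h : braid n) :
    g = word_class (@braid_rel n) u -> h = word_class (@braid_rel n) v ->
  (g * h)%g = word_class (@braid_rel n) (u ++ v).
Proof. by move=> -> ->; rewrite braid_mulE pres_mulE. Qed.

Section BraidAlgebraLift.
Variables (K : fieldType) (n : nat) (E : pzRingType) (iota : {rmorphism K -> E}).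
Variables sigma tau : 'I_n.-1 -> E.

Definition braid_rep : Prop :=
  [/\ forall k x, iota k * x = x * iota k,
      forall i, sigma i * tau i = 1 /\ tau i * sigma i = 1,
      forall i j : 'I_n.-1, j = i.+1 :> nat ->
        sigma i * sigma j * sigma i = sigma j * sigma i * sigma j
    & forall i j : 'I_n.-1, (i.+1 < j)%N -> sigma i * sigma j = sigma j * sigma i].

Hypothesis rep : braid_rep.

Definition word_eval (u : word 'I_n.-1) : E :=
  \prod_(p <- u) (if p.2 then tau p.1 else sigma p.1).

Lemma word_eval_cat u v : word_eval (u ++ v) = word_eval u * word_eval v.
Proof. exact: big_cat. Qed.

Lemma word_eval_eqv u v : pres_eqv (@braid_rel n) u v -> word_eval u = word_eval v.
Proof.
have [_ inv br3 br2] := rep.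
elim=> {u v} [//|u v _ ->//|u v w _ -> _ ->//|u u' v v' _ uu' _ vv'|i b|u v].
- by rewrite !word_eval_cat uu' vv'.
- rewrite /word_eval big_cons big_seq1 big_nil /=.
  by have [] := inv i; case: b.
- by case=> i j ij; rewrite /word_eval !big_cons big_nil /= !mulr1 ?mulrA;
    [apply: br3 | apply: br2].
Qed.

Definition braid_eval (g : braid n) : E := word_eval (repr g).

Lemma braid_eval_word u : braid_eval (word_class (@braid_rel n) u) = word_eval u.
Proof. exact/word_eval_eqv/repr_pres_eqv. Qed.

Lemma braid_evalM g h : braid_eval (g * h)%g = braid_eval g * braid_eval h.
Proof.
have [u gu] := word_class_surj g; have [v hv] := word_class_surj h.
by rewrite (braid_class_mul gu hv) gu hv !braid_eval_word word_eval_cat.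
Qed.

Lemma braid_eval1 : braid_eval 1%g = 1.
Proof. by rewrite [LHS]braid_eval_word /word_eval big_nil. Qed.

Definition lift (x : KB K n) : E :=
  \sum_(g <- msupp x) iota x@_g * braid_eval g.

Lemma lift_wide (d : {fset braid n}) (x : KB K n) : (msupp x `<=` d)%fset ->
  lift x = \sum_(g <- d) iota x@_g * braid_eval g.
Proof.
move=> xd; rewrite /lift (big_fset_incl _ xd) //= => g _ /mcoeff_outdom ->.
by rewrite rmorph0 mul0r.
Qed.

Lemma lift0 : lift 0 = 0.
Proof. by rewrite /lift msupp0 big_seq_fset0. Qed.

Lemma liftD : {morph lift : x y / x + y}.
Proof.
move=> x y; rewrite (lift_wide (msuppD_le _ _)).
rewrite (lift_wide (fsubsetUl _ (msupp y))) (lift_wide (fsubsetUr (msupp x) _)).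
rewrite -big_split; apply: eq_bigr => g _.
by rewrite mcoeffD rmorphD mulrDl.
Qed.

Lemma liftU (k : K) (g : braid n) : lift << k *g g >> = iota k * braid_eval g.
Proof. by rewrite (lift_wide msuppU_le) big_seq_fset1 mcoeffUU. Qed.

Lemma liftM : {morph lift : x y / x * y}.
Proof.
have [iotaC _ _ _] := rep.
move=> x y; elim/galg_ind: x => [|k g|x x' IH IH'].
- by rewrite mul0r lift0 mul0r.
- elim/galg_ind: y => [|l h|y y' IH IH'].
  + by rewrite mulr0 lift0 mulr0.
  + rewrite [_ * _]galg_mulUU !liftU braid_evalM rmorphM -!mulrA; congr (_ * _).
    by rewrite mulrA iotaC mulrA.
  + by rewrite mulrDr !liftD IH IH' mulrDr.
- by rewrite mulrDl !liftD IH IH' mulrDl.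
Qed.

Lemma lift1 : lift 1 = 1.
Proof.
by rewrite -galg_scal1 galg_scalE liftU rmorph1 mul1r braid_eval1.
Qed.

HB.instance Definition _ :=
  GRing.isNmodMorphism.Build (KB K n) E lift (conj lift0 liftD).
HB.instance Definition _ :=
  GRing.isMonoidMorphism.Build (KB K n) E lift (conj lift1 liftM).

Lemma lift_scal k : lift (scal k) = iota k.
Proof. by rewrite [scal k]galg_scalE liftU braid_eval1 mulr1. Qed.

Lemma lift_s i : lift (s K i) = sigma i.
Proof.
rewrite /s galg_ofE liftU rmorph1 mul1r [LHS]braid_eval_word.
by rewrite /word_eval big_seq1.
Qed.

Lemma lift_exists : exists phi : {rmorphism KB K n -> E},
  (forall k, phi (scal k) = iota k) /\ (forall i, phi (s K i) = sigma i).
Proof. by exists lift; split; [exact: lift_scal | exact: lift_s]. Qed.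

End BraidAlgebraLift.

Definition s_inv (K : fieldType) n (i : 'I_n.-1) : KB K n := galg_of K (artin i)^-1%g.

Lemma s_mulV (K : fieldType) n (i : 'I_n.-1) : s K i * s_inv K i = 1.
Proof. by rewrite /s -galg_ofM mulgV. Qed.

Lemma s_mulVl (K : fieldType) n (i : 'I_n.-1) : s_inv K i * s K i = 1.
Proof. by rewrite /s -galg_ofM mulVg. Qed.

Lemma s_braid (K : fieldType) n (i j : 'I_n.-1) : j = i.+1 :> nat ->
  s K i * s K j * s K i = s K j * s K i * s K j.
Proof.
move=> ij; rewrite /s -!galg_ofM; congr galg_of.
have gen l : artin l = word_class (@braid_rel n) [:: (l, false)] by [].
rewrite !(braid_class_mul (braid_class_mul (gen _) (gen _)) (gen _)).
by apply/pres_piP/pres_rel; constructor.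
Qed.

Lemma s_comm (K : fieldType) n (i j : 'I_n.-1) : (i.+1 < j)%N ->
  s K i * s K j = s K j * s K i.
Proof.
move=> ij; rewrite /s -!galg_ofM; congr galg_of.
have gen l : artin l = word_class (@braid_rel n) [:: (l, false)] by [].
rewrite !(braid_class_mul (gen _) (gen _)).
by apply/pres_piP/pres_rel; constructor.
Qed.

Lemma KB_ind (K : fieldType) n (X : KB K n -> Prop) :
  (forall k, X (scal k)) -> (forall i, X (s K i)) -> (forall i, X (s_inv K i)) ->
  (forall x y, X x -> X y -> X (x + y)) -> (forall x y, X x -> X y -> X (x * y)) ->
  forall x, X x.
Proof.
move=> Xk Xs Xi XD XM x.
have X1 g : X (galg_of K g).
  have [u ->] := word_class_surj g; elim: u => [|[i b] u IH].
    by have := Xk 1; rewrite scal1.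
  rewrite -cat1s -(braid_class_mul erefl erefl) galg_ofM; apply: XM => //.
  case: b; [|exact: Xs].
  suff -> : word_class (@braid_rel n) [:: (i, true)] = (artin i)^-1%g by exact: Xi.
  rewrite -[LHS](mulKg (artin i)) (braid_class_mul (erefl (artin i)) erefl).
  rewrite -[RHS]mulg1; congr (_ * _)%g.
  exact/pres_piP/pres_cancel.
elim/galg_ind: x => [|k g|x y Xx Xy]; last exact: XD.
  by have := Xk 0; rewrite [scal _]galg_scalE monalgU0.
suff -> : << k *g g >> = scal k * galg_of K g :> KB K n by apply: XM.
by rewrite [scal k]galg_scalE galg_ofE [RHS]galg_mulUU mulr1 mul1g.
Qed.

(** * Triple products of projections *)

Definition neighbours i j := (i.+1 == j) || (j.+1 == i).

Section Generators.
Variables (K : fieldType) (A : pzAlgType K) (e : 'I_3 -> K).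
Hypotheses (e_inj : injective e) (e_neq0 : forall i, e i != 0).
Hypothesis e_quad : forall i j, i != j -> e i ^+ 2 - e i * e j + e j ^+ 2 != 0.
Variables (N : nat) (s : nat -> A).
Hypothesis s_reg : forall i, (i < N)%N -> forall x, s i * x = 0 -> x = 0.
Hypothesis s_spectral : forall i, (i < N)%N -> spectral e (s i).
Hypothesis s_braid : forall i, (i.+1 < N)%N ->
  s i * s i.+1 * s i = s i.+1 * s i * s i.+1.
Hypothesis s_comm : forall i j, (i.+1 < j < N)%N -> s i * s j = s j * s i.
Hypothesis s_linked : forall i, (i.+1 < N)%N ->
  linked (eigenproj e (s i)) (eigenproj e (s i.+1)).

Notation p i := (eigenproj e (s i)).

(* P_i Q_j P_i Q_j = angle i j * P_i Q_j in the two-dimensional representation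
   of B_3 with eigenvalues e i, e j; semisimplicity of H_3 makes it nonzero. *)
Definition angle i j := (e i ^+ 2 - e i * e j + e j ^+ 2) / (e i - e j) ^+ 2.

Lemma angle_neq0 i j : i != j -> angle i j != 0.
Proof.
by move=> ij; rewrite mulf_neq0 ?e_quad ?invr_neq0 ?expf_neq0 ?subr_e.
Qed.

Lemma angle_neq1 i j : i != j -> angle i j != 1.
Proof.
move=> ij; have D := subr_e e_inj ij; rewrite -subr_eq0.
have -> : angle i j - 1 = e i * e j / (e i - e j) ^+ 2.
  by rewrite /angle; field.
by rewrite !mulf_neq0 ?invr_neq0 ?expf_neq0.
Qed.

Lemma p_frame i : (i < N)%N -> frame (p i).
Proof. by move=> /s_spectral; apply: eigenproj_frame. Qed.

Lemma p_adjacent i j : (i < N)%N -> (j < N)%N -> neighbours i j ->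
  adjacent angle (p i) (p j).
Proof.
have up k : (k.+1 < N)%N -> adjacent angle (p k) (p k.+1).
  move=> kN; have kN' := ltnW kN; have l := s_linked kN.
  split=> //; apply: eigenproj_angled => //; try exact: s_spectral.
  - exact: s_braid.
  - exact/esym/s_braid.
  - exact: linked_sym.
by move=> iN jN /orP[]/eqP E; subst; [|apply: adjacent_sym]; apply: up.
Qed.

Lemma gen_comm i j : (i < N)%N -> (j < N)%N -> i != j -> ~~ neighbours i j ->
  s i * s j = s j * s i.
Proof.
rewrite /neighbours => iN jN ij nij.
by have [lt|lt] := ltnP i j; [apply: s_comm | apply/esym/s_comm]; lia.
Qed.

Lemma p_gen_comm i j k : (i < N)%N -> (j < N)%N -> i != j -> ~~ neighbours i j ->
  p i k * s j = s j * p i k.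
Proof. by move=> *; apply/eigenproj_intertwine/gen_comm. Qed.

Lemma p_commuting i j : (i < N)%N -> (j < N)%N -> i != j -> ~~ neighbours i j ->
  commuting (p i) (p j).
Proof.
by move=> iN jN ij nij k l; apply/esym/eigenproj_intertwine/esym/p_gen_comm.
Qed.

Lemma p_braid i j k : (i < N)%N -> (j < N)%N -> neighbours i j ->
  p i k * (s j * s i) = s j * s i * p j k.
Proof.
move=> iN jN nij; apply: eigenproj_intertwine; rewrite mulrA.
by case/orP: nij => /eqP E; subst; rewrite s_braid.
Qed.

Lemma p_gen i k z : (i < N)%N -> z * p i k * s i = scal (e k) * (z * p i k).
Proof.
move=> iN; rewrite -mulrA (eigenproj_intertwine e k (erefl (s i * s i))).
by rewrite eigenproj_eig; [exact: mulr_scalCA | exact: s_spectral].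
Qed.

(** * Products along a path of generators *)

Section Path.
Variables (c : nat -> nat) (m : nat).
Hypothesis cN : forall t, (t <= m)%N -> (c t < N)%N.
Hypothesis c_step : forall t, (t < m)%N -> neighbours (c t) (c t.+1).
Hypothesis c_far : forall t u, (t.+2 <= u <= m)%N ->
  c t != c u /\ ~~ neighbours (c t) (c u).

(** The path [c] will run up or down the generators. Induction on t: t = 2 is [chain0]; t = 3 needs
    [four0], since s_(c 2) need not commute with the projections of s_(c 1); from then on a
    conjugation moves c t to c (t+1) without touching the first two factors. *)
Lemma path0 z i j k t : distinct3 i j k -> (2 <= t <= m)%N ->
  z * p (c 0) i * p (c 1) j * p (c t) k = 0.
Proof.
move=> ijk; case: t => [|[|t]] //=.
have fr u : (u <= m)%N -> frame (p (c u)) by move=> ?; apply/p_frame/cN.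
have adj u : (u < m)%N -> adjacent angle (p (c u)) (p (c u.+1)).
  by move=> um; apply: p_adjacent; [apply/cN/ltnW | apply: cN | apply: c_step].
have com u v : (u.+2 <= v <= m)%N -> commuting (p (c u)) (p (c v)).
  move=> /[dup] uv /c_far[]; case/andP: uv => uv vm.
  by apply: p_commuting; apply: cN => //; lia.
have gcom u v l : (u.+2 <= v <= m)%N -> p (c u) l * s (c v) = s (c v) * p (c u) l.
  move=> /[dup] uv /c_far[]; case/andP: uv => uv vm.
  by apply: p_gen_comm; apply: cN => //; lia.
elim: t z => [|[|t] IH] z tm.
- have [m0 m1 m2 m02] : [/\ 0 <= m, 1 <= m, 2 <= m & 0.+2 <= 2 <= m]%N by split; lia.
  exact: (chain0 (fr _ m0) (fr _ m1) (fr _ m2) (adj _ m1) (adj _ m2) (com _ _ m02)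
           angle_neq0 angle_neq1).
- have [m0 m1 m2 m3] : [/\ 0 <= m, 1 <= m, 2 <= m & 3 <= m]%N by split; lia.
  have [m02 m13 m03] : [/\ 0.+2 <= 2 <= m, 1.+2 <= 3 <= m & 0.+2 <= 3 <= m]%N.
    by split; lia.
  apply: (four0 (fr _ m0) (fr _ m1) (fr _ m2) (fr _ m3) (adj _ m1) (adj _ m2)
    (adj _ m3) (com _ _ m02) (com _ _ m13) angle_neq0 angle_neq1 e_neq0
    (r := s (c 2)) (t := s (c 3))) ijk.
  + by move=> y l; apply/p_gen/cN.
  + by move=> l; apply: gcom.
  + by move=> l; apply: gcom.
  + by move=> l; apply: p_braid; [exact: cN | exact: cN | exact: c_step].
  + exact/s_reg/cN.
- have {}IH : p (c 0) i * p (c 1) j * p (c t.+3) k = 0.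
    by rewrite -[p (c 0) i]mul1r IH //; lia.
  suff: p (c 0) i * p (c 1) j * p (c t.+4) k = 0.
    by rewrite -!mulrA => ->; rewrite mulr0.
  set u := c t.+3 in IH *; set w := c t.+4.
  have [uN wN] : (u < N)%N /\ (w < N)%N by split; apply: cN; lia.
  (* The product s_w s_u commutes with the first two projections and carries p_w back to p_u. *)
  apply: (s_reg uN); apply: (s_reg wN).
  have [f0 f1] : (0.+2 <= t.+3 <= m)%N /\ (1.+2 <= t.+3 <= m)%N by lia.
  have [g0 g1] : (0.+2 <= t.+4 <= m)%N /\ (1.+2 <= t.+4 <= m)%N by lia.
  have step : neighbours u w by apply: c_step; lia.
  move: IH (p_braid k uN wN step) (gcom _ _ i f0) (gcom _ _ j f1).
  move: (gcom _ _ i g0) (gcom _ _ j g1); rewrite -/u -/w.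
  move: (p (c 0) i) (p (c 1) j) (p u k) (p w k) => a b U W aw bw abU UW au bu.
  rewrite !mulrA -(mulrA _ (s u)) -au mulrA -aw -!mulrA (mulrA (s u)) -bu.
  by rewrite !mulrA -(mulrA a) -bw -!mulrA [s w * (_ * _)]mulrA -UW !mulrA abU !mul0r.
Qed.

End Path.

Lemma path_up0 z i l x y w : distinct3 x y w -> (i.+1 < l < N)%N ->
  z * p i x * p i.+1 y * p l w = 0.
Proof.
move=> xyw il.
pose c t := (i + t)%N.
have cN t : (t <= (N - i).-1)%N -> (c t < N)%N by rewrite /c; lia.
have step t : (t < (N - i).-1)%N -> neighbours (c t) (c t.+1).
  by rewrite /neighbours /c addnS eqxx.
have far t u : (t.+2 <= u <= (N - i).-1)%N ->
    c t != c u /\ ~~ neighbours (c t) (c u).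
  by rewrite /neighbours /c; lia.
have cl : c (l - i)%N = l by rewrite /c; lia.
have := @path0 _ _ cN step far z x y w (l - i) xyw.
by rewrite cl /c addn0 addn1; apply; lia.
Qed.

Lemma path_down0 z i l x y w : distinct3 x y w -> (i.+1 < N)%N -> (l < i)%N ->
  z * p i.+1 x * p i y * p l w = 0.
Proof.
move=> xyw iN li.
(* As t is at most i + 1 along the path, the subtraction never truncates. *)
pose c t := (i.+1 - t)%N.
have cN t : (t <= i.+1)%N -> (c t < N)%N by rewrite /c; lia.
have step t : (t < i.+1)%N -> neighbours (c t) (c t.+1).
  by rewrite /neighbours /c; lia.
have far t u : (t.+2 <= u <= i.+1)%N ->
    c t != c u /\ ~~ neighbours (c t) (c u).
  by rewrite /neighbours /c; lia.
have cl : c (i.+1 - l)%N = l by rewrite /c; lia.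
have := @path0 _ _ cN step far z x y w (i.+1 - l) xyw.
by rewrite cl /c subn0 subSS subn0; apply; lia.
Qed.

(** If l is i or j this is [triple0] or orthogonality. Otherwise one of the two orders of i and j
    starts a path towards l, and [swap0] gives the other order. *)
Lemma neighbour_triple0 z i j l x y w : distinct3 x y w ->
  (i < N)%N -> (j < N)%N -> (l < N)%N -> neighbours i j ->
  z * p i x * p j y * p l w = 0.
Proof.
move=> xyw iN jN lN nij; have [xy xw yw] := xyw.
have yxw : distinct3 y x w by permute3.
have [li|li] := eqVneq l i.
  by rewrite li triple0 //; [exact: p_frame | case: (p_adjacent iN jN nij)].
have [lj|lj] := eqVneq l j; first by rewrite lj frame_orth //; exact: p_frame.
have both k : (k.+1 < N)%N -> l != k -> l != k.+1 -> forall u v z', distinct3 u v w ->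
    z' * p k u * p k.+1 v * p l w = 0 /\ z' * p k.+1 u * p k v * p l w = 0.
  move=> kN lk lk1 u v z' uvw; have kN' := ltnW kN.
  have vuw : distinct3 v u w by permute3.
  have [uv _ _] := uvw; have [vu _ _] := vuw.
  have adj := p_adjacent kN' kN; have adj' := p_adjacent kN kN'.
  have [kl|lk2] := ltnP k.+1 l.
    have up y' x' z'' := @path_up0 z'' k l x' y' w.
    split; first by apply: up; rewrite ?kl.
    by apply: (swap0 (p_frame kN) (adj _)) => // [|z''|z'']; rewrite ?up ?kl //
      /neighbours eqxx.
  have {lk2} lk3 : (l < k)%N by lia.
  have down y' x' z'' := @path_down0 z'' k l x' y' w.
  split; last by apply: down.
  by apply: (swap0 (p_frame kN') (adj' _)) => // [|z''|z'']; rewrite ?down //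
    /neighbours eqxx orbT.
case/orP: nij => /eqP E; subst.
  by have [] := both i jN li lj x y z xyw.
by have [] := both j iN lj li x y z xyw.
Qed.

Definition annihilates w z := forall l, (l < N)%N -> z * p l w = 0.

Lemma annihilates_stable w z m x : (m < N)%N ->
  annihilates w z -> annihilates w (z * p m x).
Proof.
move=> mN zw l lN; have [->|xw] := eqVneq x w; first by rewrite zw ?mul0r.
have [->|ml] := eqVneq m l; first by rewrite frame_orth //; apply: p_frame.
have [nml|nml] := boolP (neighbours m l); last first.
  by rewrite (commutingA _ _ _ (p_commuting mN lN ml nml)) zw ?mul0r.
apply: (annihilator_stable (p_frame mN) (p_frame lN) (p_adjacent mN lN nml)) => //.
- exact: angle_neq0.
- exact: zw.
- exact: zw.
Qed.

Lemma annihilatesD w y z : annihilates w y -> annihilates w z -> annihilates w (y + z).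
Proof. by move=> yw zw l lN; rewrite mulrDl yw ?zw ?addr0. Qed.

Lemma annihilatesZ w k z : annihilates w z -> annihilates w (scal k * z).
Proof. by move=> zw l lN; rewrite -mulrA zw ?mulr0. Qed.

Lemma annihilates_pair z i j x y w : distinct3 x y w ->
  (i < N)%N -> (j < N)%N -> i != j -> annihilates w (z * p i x * p j y).
Proof.
move=> xyw iN jN ij.
have near a b u v t z' : distinct3 u v t -> (a < N)%N -> (b < N)%N -> neighbours a b ->
    annihilates t (z' * p a u * p b v).
  by move=> uvt aN bN ab l lN; apply: neighbour_triple0.
(* Induction on the distance. Insert the sum of the projections of s_(a+1) after p_a(u): the u term
   has a shorter distance, the v term falls under [annihilates_stable], and the t term is zero. *)
have far d : forall a u v t z', distinct3 u v t -> (a + d.+1 < N)%N ->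
    annihilates t (z' * p a u * p (a + d.+1) v).
  elim: d => [|d IH] a u v t z' uvt aN.
    by apply: near; rewrite /neighbours ?addn1 ?eqxx //; lia.
  have utv : distinct3 u t v by permute3.
  have aN' : (a < N)%N by lia.
  have a1N : (a.+1 < N)%N by lia.
  have a_near : neighbours a a.+1 by rewrite /neighbours eqxx.
  rewrite -addSnnS; rewrite -addSnnS in aN.
  rewrite (frame_split (z' * p a u) (p_frame a1N) uvt) !mulrDl.
  do 2?apply: annihilatesD.
  - exact: IH.
  - by apply: annihilates_stable => //; apply: near.
  - by move=> l lN; rewrite (near _ _ _ _ _ _ utv) ?mul0r.
have [lt|le] := ltnP i j; first by rewrite -(subnKC lt) addSnnS; apply: far => //; lia.
have lt : (j < i)%N by rewrite ltn_neqAle le eq_sym ij.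
have [nij|nij] := boolP (neighbours i j); first exact: near.
(* Here i > j + 1: the projections commute and the roles of x and y are exchanged. *)
rewrite (commutingA _ _ _ (p_commuting iN jN ij nij)).
have yxw : distinct3 y x w by permute3.
by rewrite -(subnKC lt) addSnnS; apply: far => //; lia.
Qed.

Lemma triple_eq0 z i j l x y w : distinct3 x y w ->
  (i < N)%N -> (j < N)%N -> (l < N)%N -> z * p i x * p j y * p l w = 0.
Proof.
move=> xyw iN jN lN; have [<-|ij] := eqVneq i j; last exact: annihilates_pair.
by have [xy _ _] := xyw; rewrite frame_orth ?mul0r //; apply: p_frame.
Qed.

Lemma gen_combine i : (i < N)%N -> combine (p i) e = s i.
Proof.
move=> iN; rewrite /combine !big_ord_recl big_ord0 addr0 addrA.
by apply/esym/eigenproj_sum => //; apply: s_spectral.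
Qed.

(** * The triangular representations of the braid group *)

Section Representation.
Hypothesis N_gt0 : (0 < N)%N.
Variable pi : {rmorphism KB K N.+1 -> A}.
Hypothesis pi_scal : forall k, pi (scal k) = scal k.
Hypothesis pi_s : forall i : 'I_N, pi (@Defs.s K N.+1 i) = s i.

Definition e_inv i := (e i)^-1.

Lemma combine_inv (P : 'I_3 -> A) : frame P -> combine P e_inv * combine P e = 1.
Proof.
move=> fP; rewrite combineM // -[RHS]scal1 -(combine_cst fP); congr combine.
by apply: boolp.funext => i; rewrite mulVf.
Qed.

Lemma pi_s_inv i : pi (@s_inv K N.+1 i) = combine (p i) e_inv.
Proof.
have h := combine_inv (p_frame (ltn_ord i)); rewrite gen_combine // in h.
apply: (inverse_eq h).
by rewrite -pi_s -rmorphM s_mulV rmorph1.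
Qed.

Lemma annihilates_pi w z x : annihilates w z -> annihilates w (z * pi x).
Proof.
have comb i f u : (i < N)%N -> annihilates w u -> annihilates w (u * combine (p i) f).
  move=> iN uw; rewrite /combine !big_ord_recl big_ord0 addr0 !mulrDr.
  by do 2?apply: annihilatesD; rewrite mulr_scalCA; apply: annihilatesZ;
    apply: annihilates_stable.
elim/KB_ind: x z => [k|i|i|x y IHx IHy|x y IHx IHy] z zw.
- by rewrite pi_scal -scalC; apply: annihilatesZ.
- by rewrite pi_s -gen_combine //; apply: comb.
- by rewrite pi_s_inv; apply: comb.
- by rewrite rmorphD mulrDr; apply: annihilatesD; [apply: IHx | apply: IHy].
- by rewrite rmorphM mulrA; apply: IHy; apply: IHx.
Qed.

Section Letters.
Variables a b c : 'I_3.
Hypothesis abc : distinct3 a b c.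

Local Notation v := (p 0%N a).
Definition gen_rep i f := gen_mx (p i) a b v f.

(** A braid relation involves two generators only, so a corner [w] depending on the pair is enough
    to reduce it to the relation between the generators. *)
Lemma gen_rep_splitting i j : (i < N)%N -> (j < N)%N -> i != j ->
  exists w, forall f, gen_rep i f = tri_conj w (f a) (combine (p i) f) /\
                      gen_rep j f = tri_conj w (f a) (combine (p j) f).
Proof.
move=> iN jN ij; have acb : distinct3 a c b by permute3.
have v1 : v = 1 * v by rewrite mul1r.
have vij : v * p i b * p j c = 0 by rewrite v1 triple_eq0.
have vji : v * p i c * p j b = 0 by rewrite v1 triple_eq0.
have [fi fj] := (p_frame iN, p_frame jN).
have [w [wb wc wb' wc']] : exists w, splitting (p i) (p j) b c v w.
  have [nij|nij] := boolP (neighbours i j).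
    have [ab _ _] := abc.
    exact: (splitting_adjacent fi fj abc vij vji (p_adjacent iN jN nij) (angle_neq0 ab)).
  exact: (splitting_commuting fi fj abc vij vji (p_commuting iN jN ij nij)).
by exists w => f; split; [apply: (gen_mx_conj fi f abc) | apply: (gen_mx_conj fj f abc)].
Qed.

Lemma gen_rep_mul1 i f g : (i < N)%N -> (forall x, f x * g x = 1) ->
  gen_rep i f * gen_rep i g = 1.
Proof.
move=> iN fg; rewrite /gen_rep gen_mxM; last exact: p_frame.
have -> : (fun x => f x * g x) = fun=> 1 by apply: boolp.funext.
by rewrite gen_mx_cst -?tri_scalar ?scal1 //; apply: p_frame.
Qed.

Lemma gen_rep_lift : exists phi : {rmorphism KB K N.+1 -> 'M[A]_2},
  [/\ forall k, phi (scal k) = tri k 0 (scal k),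
      forall i : 'I_N, phi (@Defs.s K N.+1 i) = gen_rep i e
    & forall i : 'I_N, phi (@s_inv K N.+1 i) = gen_rep i e_inv].
Proof.
have rep : @braid_rep K N.+1 'M[A]_2 (scalar_mx \o @scal K A)
    (fun i => gen_rep i e) (fun i => gen_rep i e_inv).
  split=> [k M|i|i j ij|i j ij].
  - exact: tri_scalarC.
  - by split; apply: gen_rep_mul1 => // x; [apply: mulfV | apply: mulVf].
  - have ijN : (i.+1 < N)%N by rewrite -ij; apply: ltn_ord.
    have [|w wE] := gen_rep_splitting (ltn_ord i) (ltn_ord j); first by rewrite ij; lia.
    have [-> ->] := wE e.
    by rewrite !tri_conjM !gen_combine // ij s_braid.
  - have ijN : (i.+1 < j < N)%N by rewrite ij; apply: ltn_ord.
    have [|w wE] := gen_rep_splitting (ltn_ord i) (ltn_ord j); first by lia.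
    have [-> ->] := wE e.
    by rewrite !tri_conjM !gen_combine // s_comm.
have [phi [phi_scal phi_s]] := lift_exists rep.
exists phi; split=> [k|//|i]; first by rewrite phi_scal [LHS]tri_scalar.
apply: (@inverse_eq _ (gen_rep i e)).
  by apply: gen_rep_mul1 => // x; apply: mulVf.
by rewrite -phi_s -rmorphM s_mulV rmorph1.
Qed.

End Letters.

(** [phi] and [psi] belong to the pairs (a, b) and (a, c); k, u, w are theta(x), d_ab(x), d_ac(x).
    The annihilation of [u] and [w] is carried along because it makes these corners vanish against
    J(a, b) and J(a, c). *)
Lemma pi_triangular a b c : distinct3 a b c ->
  exists phi psi : {rmorphism KB K N.+1 -> 'M[A]_2},
  [/\ forall i : 'I_N, phi (@Defs.s K N.+1 i) = gen_rep a b i e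
    , forall i : 'I_N, psi (@Defs.s K N.+1 i) = gen_rep a c i e
    , forall k, phi (scal k) = tri k 0 (scal k)
    , forall k, psi (scal k) = tri k 0 (scal k)
    & forall x, exists k u w,
       [/\ phi x = tri k u (pi x), psi x = tri k w (pi x), annihilates c u, annihilates b w
         & p 0%N a * pi x = u + w + scal k * p 0%N a]].
Proof.
move=> abc; have acb : distinct3 a c b by permute3.
have [phi [phik phis phiV]] := gen_rep_lift abc.
have [psi [psik psis psiV]] := gen_rep_lift acb.
exists phi, psi; split=> //.
have gen f (i : 'I_N) x : phi x = gen_rep a b i f -> psi x = gen_rep a c i f ->
    pi x = combine (p i) f -> exists k u w,
    [/\ phi x = tri k u (pi x), psi x = tri k w (pi x), annihilates c u, annihilates b w
      & p 0%N a * pi x = u + w + scal k * p 0%N a].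
  move=> -> -> ->; exists (f a); do 2!eexists; split; [reflexivity | reflexivity | | |].
  - by apply/annihilatesZ; rewrite -[p 0%N a]mul1r => l lN; apply: triple_eq0.
  - by apply/annihilatesZ; rewrite -[p 0%N a]mul1r => l lN; apply: triple_eq0.
  - exact: (combine_corner (p_frame (ltn_ord i)) _ _ abc).
elim/KB_ind => [k|i|i|x y [k [u [w [xu xw uc wb vx]]]] [l [t [z [yt yz tc zb vy]]]]
  |x y [k [u [w [xu xw uc wb vx]]]] [l [t [z [yt yz tc zb vy]]]]].
- exists k, 0, 0; rewrite phik psik pi_scal scalC !add0r.
  by split=> // i iN; rewrite mul0r.
- by apply: (gen e i); rewrite ?pi_s ?gen_combine.
- by apply: (gen e_inv i) => //; apply: pi_s_inv.
- exists (k + l), (u + t), (w + z); rewrite !rmorphD xu yt xw yz !triD mulrDr vx vy.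
  split=> //; try exact: annihilatesD.
  by rewrite mulrDl addrACA; congr (_ + _); rewrite addrACA.
- exists (k * l), (scal k * t + u * pi y), (scal k * z + w * pi y).
  rewrite !rmorphM xu yt xw yz !triM mulrA vx !mulrDl -(mulrA (scal k)) vy !mulrDr.
  split=> //; try by apply/annihilatesD; [apply: annihilatesZ | apply: annihilates_pi].
  rewrite mulrA addrA; congr (_ + _).
  by rewrite addrACA; congr (_ + _); exact: addrC.
Qed.

Lemma J_triangular a b c (phi : {rmorphism KB K N.+1 -> 'M[A]_2}) : distinct3 a b c ->
  (forall i : 'I_N, phi (@Defs.s K N.+1 i) = gen_rep a b i e) ->
  (forall k, phi (scal k) = tri k 0 (scal k)) ->
  (forall x, exists k u, phi x = tri k u (pi x) /\ annihilates c u) ->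
  forall x, J N.+1 (e a) (e b) x -> phi x = tri 0 0 (pi x).
Proof.
move=> abc phis phik tr x Jx; have [ab ac bc] := abc.
(* The second clause makes this a two-sided ideal: the corner of phi(y z) contains u pi(z), with u
   the corner of phi(y). *)
pose I (y : KB K N.+1) :=
  phi y = tri 0 0 (pi y) /\ forall u, annihilates c u -> u * pi y = 0.
have idI : two_sided_ideal I.
  split=> [|y z [yI yc] [zI zc]|y z [zI zc]|y z [yI yc]].
  - split=> [|u _]; last by rewrite rmorph0 mulr0.
    by have := phik 0; rewrite !scal0 (rmorph0 pi).
  - by split=> [|u uc]; rewrite !rmorphD ?yI ?zI ?triD ?addr0 // mulrDr yc ?zc ?addr0.
  - have [k [u [yu uc]]] := tr y; split=> [|w wc].
      by rewrite !rmorphM zI yu triM zc // !mulr0 addr0.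
    by rewrite rmorphM mulrA zc //; apply: annihilates_pi.
  - have [k [u [zu uc]]] := tr z; split=> [|w wc].
      by rewrite !rmorphM yI zu triM scal0 !mul0r addr0.
    by rewrite rmorphM mulrA yc ?mul0r.
suff SI y : (exists2 s1 : 'I_N, s1 = 0%N :> nat &
    y = (@Defs.s K N.+1 s1 - scal (e a)) * (@Defs.s K N.+1 s1 - scal (e b))) -> I y.
  by have [] := Jx I (conj idI SI).
move=> [i i0 ->{y}]; have f0 := p_frame N_gt0.
(* At s_1 the corner is a multiple of p_a(1) p_b(1) = 0, so the matrix is diagonal. *)
have phi0 : phi (@Defs.s K N.+1 i) = tri (e a) 0 (s 0%N).
  rewrite phis /gen_rep i0 /gen_mx gen_combine // -[p 0%N a]mul1r.
  by rewrite frame_orth // mulr0.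
have triB k l y z : tri k 0 y - tri l 0 z = tri (k - l) 0 (y - z) :> 'M[A]_2.
  by apply/eqP; rewrite subr_eq triD addr0 !subrK.
split=> [|u uc]; rewrite !rmorphM !rmorphB !pi_scal pi_s i0.
  by rewrite phi0 !phik !triB triM subrr scal0 !mul0r addr0.
have cab : distinct3 c a b by permute3.
have [ca cb _] := cab.
(* With this factor, (s_1 - e_a)(s_1 - e_b) becomes p_c(1), and u p_c(1) = 0. *)
apply: (@scal_eq0 _ _ ((e c - e a) * (e c - e b))^-1).
  by rewrite invr_neq0 // mulf_neq0 // subr_e.
by rewrite -(uc 0%N N_gt0) (eigenprojE _ _ cab) quadE mulr_scalCA.
Qed.

Lemma pi_eq0 x : (forall a b, a != b -> J N.+1 (e a) (e b) x) -> pi x = 0.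
Proof.
move=> Jx; suff vx a : p 0%N a * pi x = 0.
  have [_ f1] := p_frame N_gt0.
  have d : distinct3 (0 : 'I_3) 1 2 by [].
  by rewrite -[pi x]mul1r -(f1 _ _ _ d) !mulrDl !vx !addr0.
have [b [c abc]] : exists b c, distinct3 a b c.
  by exists (a + 1), (a + 2); case: a => [[|[|[|//]]] ?].
have [phi [psi [phis psis phik psik tr]]] := pi_triangular abc.
have acb : distinct3 a c b by permute3.
have [ab ac bc] := abc; have [k [u [w [xu xw _ _ ->]]]] := tr x.
have phi_tr y : exists k u, phi y = tri k u (pi y) /\ annihilates c u.
  by have [l [t [z []]]] := tr y; exists l, t.
have psi_tr y : exists k u, psi y = tri k u (pi y) /\ annihilates b u.
  by have [l [t [z []]]] := tr y; exists l, z.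
have := J_triangular abc phis phik phi_tr (Jx _ _ ab).
have := J_triangular acb psis psik psi_tr (Jx _ _ ac).
rewrite xu xw => ew eu; rewrite -(tri_corner k u (pi x)) -(tri_corner k w (pi x)).
rewrite ew eu !tri_corner !add0r.
(* Only [scal k = 0] is read off, not k = 0: A may be the zero ring. *)
have /(congr1 (fun M : 'M[A]_2 => M 0 0)) := eu.
by rewrite !mxE /= => ->; rewrite scal0 mul0r.
Qed.

End Representation.

End Generators.

(** * The natural morphism *)

(** Von Neumann regularity, from the pseudo-inverses of the matrix components. *)
Lemma split_semisimple_regular (K : fieldType) (A : pzAlgType K) :
  split_semisimple A -> forall x : A, exists y, x * y * x = x.
Proof.
move=> [r [d [f [_ f_bij]]]] x.
have [y [fy _]] := f_bij (fun i => pinvmx (f i x)).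
exists y; have [z [_ z_uniq]] := f_bij (fun i => f i x).
rewrite -(z_uniq (x * y * x)) ?(z_uniq x) // => i.
by rewrite !rmorphM fy; apply: mulmxKpV.
Qed.

Lemma ideal_gen_min (A : pzRingType) (S : A -> Prop) (I : ideal A) :
  (forall x, S x -> I x) -> forall x, ideal_gen S x -> I x.
Proof. by move=> SI x Sx; apply: (Sx I); split=> //; apply: ideal_axiom. Qed.

Lemma ideal_gen_sub (A : pzRingType) (S : A -> Prop) x : S x -> ideal_gen S x.
Proof. by move=> Sx I [_]; apply. Qed.

Section QuotientLift.
Variables (K : fieldType) (A : pzAlgType K) (I : ideal A) (B : pzRingType).
Variable g : {rmorphism A -> B}.
Hypothesis gI : forall x, I x -> g x = 0.

Definition quot_lift (q : quot I) : B := g (repr q).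

Lemma quot_liftE x : quot_lift (proj I x) = g x.
Proof.
apply/eqP; rewrite -subr_eq0 -rmorphB; apply/eqP/gI; exact: repr_proj.
Qed.

Lemma quot_liftD : {morph quot_lift : p q / p + q}.
Proof.
move=> p q; have [x ->] := proj_surj p; have [y ->] := proj_surj q.
by rewrite -projD !quot_liftE rmorphD.
Qed.

Lemma quot_liftM : {morph quot_lift : p q / p * q}.
Proof.
move=> p q; have [x ->] := proj_surj p; have [y ->] := proj_surj q.
by rewrite -projM !quot_liftE rmorphM.
Qed.

Lemma quot_lift0 : quot_lift 0 = 0.
Proof. by rewrite [LHS]quot_liftE rmorph0. Qed.

Lemma quot_lift1 : quot_lift 1 = 1.
Proof. by rewrite [LHS]quot_liftE rmorph1. Qed.

HB.instance Definition _ :=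
  GRing.isNmodMorphism.Build (quot I) B quot_lift (conj quot_lift0 quot_liftD).
HB.instance Definition _ :=
  GRing.isMonoidMorphism.Build (quot I) B quot_lift (conj quot_lift1 quot_liftM).

Lemma quot_lift_exists :
  exists f : {rmorphism quot I -> B}, forall x, f (proj I x) = g x.
Proof. exists quot_lift; exact: quot_liftE. Qed.

End QuotientLift.

Lemma proj_eq0 (K : fieldType) (A : pzAlgType K) (I : ideal A) x :
  proj I x = 0 <-> I x.
Proof. by rewrite -[X in _ = X]/(proj I 0) projP subr0. Qed.

Lemma scal_galg_inj (K : fieldType) (G : groupType) : injective (@scal K (galg K G)).
Proof.
move=> k l /(congr1 (monalg.mcoeff 1%g)).
by rewrite ![scal _]galg_scalE !monalg.mcoeffUU.
Qed.

(* If x^2 - xy + y^2 = 0, then s_1 = diag(x, y) and s_2 = s_1 + E_12 define a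
   representation in which the image of s_1 - s_2 is not von Neumann regular. *)
Lemma regular_quadratic (K : fieldType) (A : pzAlgType K) (a b c x y : K) :
  1 <> 0 :> A ->
  (forall z : Hecke 3 a b c, exists t, z * t * z = z) ->
  x != 0 -> y != 0 ->
  (x - a) * (x - b) * (x - c) = 0 -> (y - a) * (y - b) * (y - c) = 0 ->
  x ^+ 2 - x * y + y ^+ 2 != 0.
Proof.
move=> A_neq0 reg x0 y0 xabc yabc; apply/eqP => xy0.
pose i0 : 'I_3.-1 := @Ordinal 2 0 isT; pose i1 : 'I_3.-1 := @Ordinal 2 1 isT.
(* The corner is 0 for s_1 and 1 for s_2; the braid relation then comes down to x^2 - x y + y^2 =
   0. *)
pose sg (i : 'I_2) : 'M[A]_2 := tri x (scal (i : nat)%:R) (scal y).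
pose ta (i : 'I_2) : 'M[A]_2 := tri x^-1 (scal (- (i : nat)%:R / (x * y))) (scal y^-1).
have tri1 : 1 = tri 1 0 1 :> 'M[A]_2.
  by have := tri_scalar A 1; rewrite scal1 => <-.
have rep : @braid_rep K 3 'M[A]_2 (scalar_mx \o @scal K A) sg ta.
  split=> [k M|i|i j ij|i j ij].
  - exact: tri_scalarC.
  - rewrite tri1 !triM -!scalM -!scalD !mulfV // !mulVf // scal1.
    by split; congr tri; rewrite -[RHS](scal0 A); congr scal; field; rewrite ?x0 ?y0.
  - rewrite /sg !triM -!scalM -!scalD; congr tri.
    have -> : (i : nat) = 0%N by case: i j ij => [[|[|//]] p] [[|[|//]] q].
    have -> : (j : nat) = 1%N by case: i j ij => [[|[|//]] p] [[|[|//]] q].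
    rewrite -!(scalM, scalD); congr scal; apply/eqP;
    rewrite -subr_eq0 -oppr_eq0 -[X in _ == X]xy0.
    by apply/eqP; ring.
  - by exfalso; case: i j ij => [[|[|//]] p] [[|[|//]] q].
have [phi [phik phis]] := lift_exists rep.
have {}phik k : phi (scal k) = tri k 0 (scal k) by rewrite phik [LHS]tri_scalar.
have tri0 : 0 = tri 0 0 0 :> 'M[A]_2.
  by have := tri_scalar A 0; rewrite scal0 raddf0.
have triN k u z : - tri k u z = tri (- k) (- u) (- z) :> 'M[A]_2.
  by apply: (addrI (tri k u z)); rewrite subrr triD !subrr.
have phiV i : phi (s_inv K i) = ta i.
  have [_ inv _ _] := rep; have [_ taS] := inv i.
  by apply: (inverse_eq taS); rewrite -phis -rmorphM s_mulV rmorph1.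
have phi_tri z : exists k u w, phi z = tri k u w.
  elim/KB_ind: z => [k|i|i|z t [k [u [w zE]]] [l [v [q tE]]]
    |z t [k [u [w zE]]] [l [v [q tE]]]].
  - by rewrite phik; do 3!eexists.
  - by rewrite phis; do 3!eexists.
  - by rewrite phiV; do 3!eexists.
  - by rewrite rmorphD zE tE triD; do 3!eexists.
  - by rewrite rmorphM zE tE triM; do 3!eexists.
have phi0 z : cubic_ideal 3 a b c z -> phi z = 0.
  move=> zI; have idI : two_sided_ideal (fun z => phi z = 0).
    split=> [|t t' t0 t'0|t t' t0|t t' t0]; first exact: rmorph0.
    - by rewrite rmorphD t0 t'0 addr0.
    - by rewrite rmorphM t0 mulr0.
    - by rewrite rmorphM t0 mul0r.
  apply: (@ideal_gen_min _ _ (Ideal idI) _ z zI) => {zI} t [i ie ->] /=.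
  rewrite !rmorphM !rmorphB !phik phis /sg ie scal0 !triN !triD !oppr0 !addr0.
  by rewrite !triM !mulr0 !mul0r !addr0 xabc -!scalN
    -!scalD -!scalM yabc mul0r addr0 scal0.
(* A triangular matrix between two copies of phi(s_1 - s_2) = - E_12 gives zero, so regularity would
   force the corner -1 to vanish in A. *)
have [t tE] := reg (proj _ (@s K 3 i0) - proj _ (@s K 3 i1)).
have [t' t'E] := proj_surj t; move: tE; rewrite t'E -rmorphB -!rmorphM => /projP /phi0.
have [k [u [w t'tri]]] := phi_tri t'.
have sub : phi (@s K 3 i0 - @s K 3 i1) = tri 0 (-1) 0.
  by rewrite rmorphB !phis /sg triN triD scal0 scal1 !subrr add0r.
rewrite rmorphB !rmorphM t'tri sub !triM triN triD tri0.
move=> /(congr1 (fun M : 'M[A]_2 => M 0 1)); rewrite !tri_corner.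
by rewrite !mul0r !mulr0 scal0 !mul0r !addr0 opprK add0r.
Qed.

(** * Transport of relations by conjugation *)

Section Conjugation.
Variables (K : fieldType) (A : pzAlgType K) (e : 'I_3 -> K).

Lemma spectral_conj (x y w : A) : (forall z, w * z = 0 -> z = 0) -> x * w = w * y ->
  spectral e x -> spectral e y.
Proof.
move=> w_reg xw sx i j k ijk; apply: w_reg.
have sub l : w * (y - scal l) = (x - scal l) * w by rewrite mulrBr mulrBl xw scalC.
by rewrite !mulrA sub -(mulrA _ w) sub !mulrA -(mulrA _ w) sub mulrA sx ?mul0r.
Qed.

Lemma linked_conj (P P' Q Q' : 'I_3 -> A) w : (forall z, w * z = 0 -> z = 0) ->
  (forall i, P i * w = w * Q i) -> (forall i, P' i * w = w * Q' i) ->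
  linked P P' -> linked Q Q'.
Proof.
move=> w_reg PQ PQ' PP i j; apply/eqP; rewrite -subr_eq0; apply/eqP/w_reg.
have mv R S R' S' : R * w = w * S -> R' * w = w * S' -> w * (S * S') = R * R' * w.
  by move=> RS RS'; rewrite mulrA -RS -mulrA -RS' mulrA.
rewrite !mulrBr !(mv _ _ _ _ (PQ _) (PQ' _)) !(mv _ _ _ _ (PQ' _) (PQ _)).
by rewrite -!mulrBl PP subrr mul0r.
Qed.

End Conjugation.

Definition letter (K : fieldType) (a b c : K) (i : 'I_3) := nth 0 [:: a; b; c] i.

Lemma spectralP (K : fieldType) (A : pzAlgType K) (a b c : K) (x : A) :
  (x - scal a) * (x - scal b) * (x - scal c) = 0 -> spectral (letter a b c) x.
Proof.
have com l m : (x - scal l) * (x - scal m) = (x - scal m) * (x - scal l).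
  by rewrite !quadE (addrC l) (mulrC l).
have swap12 l m n : (x - scal l) * (x - scal m) * (x - scal n) =
    (x - scal m) * (x - scal l) * (x - scal n) by rewrite com.
have swap23 l m n : (x - scal l) * (x - scal m) * (x - scal n) =
    (x - scal l) * (x - scal n) * (x - scal m) by rewrite -mulrA com mulrA.
move=> x0 i j k [].
case: i j k => [[|[|[|//]]] p] [[|[|[|//]]] q] [[|[|[|//]]] r] //= _ _ _;
  rewrite /letter /=; first
  [ exact: x0 | by rewrite swap12 | by rewrite swap23 | by rewrite swap12 swap23
  | by rewrite swap23 swap12 | by rewrite swap12 swap23 swap12].
Qed.

(** The generator of [calK_ideal] at u = s_1, v = s_2; it equals [u^2, v] - [u, v^2]. *)
Definition braid_relator (R : pzRingType) (u v : R) :=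
  v * v * u - u * (v * v) - v * (u * u) + u * u * v.

Lemma rmorph_relator (R S : pzRingType) (f : {rmorphism R -> S}) u v :
  f (braid_relator u v) = braid_relator (f u) (f v).
Proof. by rewrite /braid_relator rmorphD !rmorphB !rmorphM. Qed.

(** With u^2 = (x + y) u - x y and the same for v, both [u^2, v] and [u, v^2] are (x + y) [u, v]. *)
Lemma relator_quadratic (K : fieldType) (A : pzAlgType K) (x y : K) (u v : A) :
  (u - scal x) * (u - scal y) = 0 -> (v - scal x) * (v - scal y) = 0 ->
  braid_relator u v = 0.
Proof.
have lin w : (w - scal x) * (w - scal y) = 0 ->
      w * w = scal (x + y) * w - scal (x * y) :> A.
  by rewrite quadE => /eqP; rewrite -addrA addr_eq0 => /eqP ->; rewrite opprD opprK.
rewrite /braid_relator => /lin -> /lin ->; move: (x + y) (x * y) => k l.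
rewrite !mulrBl !mulrBr !mulr_scalCA -!(scalC l) -!(mulrA (scal k)) !opprB.
by rewrite [LHS](AC (2*2*2*2) ((1*6)*(2*3)*(4*7)*(5*8))) /= !subrr !addNr !addr0.
Qed.

Section NaturalMorphism.
Variables (K : fieldType) (m : nat) (a b c : K).
Local Notation n := m.+3.

Lemma J_sym (x y : K) z : J n x y z -> J n y x z.
Proof.
apply: ideal_gen_min => {}z [i ie ->]; apply: ideal_gen_sub; exists i => //.
by rewrite !quadE (addrC x) (mulrC x).
Qed.

(** In the quotient by J(x, y), s_2 is conjugate to s_1 and so satisfies the same quadratic
    equation; [relator_quadratic] applies. *)
Lemma J_relator (x y : K) (i j : 'I_n.-1) : i = 0%N :> nat -> j = 1%N :> nat ->
  J n x y (braid_relator (s K i) (s K j)).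
Proof.
move=> ie je; apply/proj_eq0; pose pr := proj (J n x y).
have prk k : pr (scal k) = scal k by [].
set S := pr (s K i); set T := pr (s K j).
have quad0 : (S - scal x) * (S - scal y) = 0.
  by rewrite -!prk -!rmorphB -rmorphM; apply/proj_eq0; apply: ideal_gen_sub; exists i.
have w_reg z : T * S * z = 0 -> z = 0.
  move=> wz; rewrite -[z]mul1r -(rmorph1 pr) -(s_mulVl K i) rmorphM -/S.
  rewrite -(mulrA _ S) -[S * z]mul1r -(rmorph1 pr) -(s_mulVl K j) rmorphM -/T.
  by rewrite -(mulrA _ T) (mulrA T) wz !mulr0.
have ST : S * (T * S) = T * S * T.
  by rewrite mulrA -!rmorphM s_braid // ie je.
have sub l : T * S * (T - scal l) = (S - scal l) * (T * S).
  by rewrite mulrBr -ST mulrBl scalC.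
have quad1 : (T - scal x) * (T - scal y) = 0.
  by apply: w_reg; rewrite mulrA sub -mulrA sub mulrA quad0 mul0r.
by rewrite [LHS]rmorph_relator; apply: relator_quadratic quad1.
Qed.

Lemma cubic_sub_J (x y : K) z :
  (x, y) \in [:: (a, b); (a, c); (b, c)] -> cubic_ideal n a b c z -> J n x y z.
Proof.
move=> xy; apply: ideal_gen_min => {}z [i ie ->].
have Jxy : J n x y ((s K i - scal x) * (s K i - scal y)).
  by apply: ideal_gen_sub; exists i.
move: xy Jxy; rewrite !inE => /or3P[] /eqP[-> ->] Jxy.
- exact: (@Defs.idealMr K (KB K n) (J n a b)).
- rewrite -mulrA (_ : _ * (_ - scal c) = (s K i - scal c) * (s K i - scal b)).
    by rewrite mulrA; apply: (@Defs.idealMr K (KB K n) (J n a c)).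
  by rewrite !quadE (addrC b) (mulrC b).
- by rewrite -mulrA; apply: (@Defs.idealMl K (KB K n) (J n b c)).
Qed.

Lemma calH_idealE z :
  calH_ideal n a b c z <-> [/\ J n a b z, J n a c z & J n b c z].
Proof. by split=> [[[? ?] ?]|[]]. Qed.

Lemma natural_map : exists g : {rmorphism calK n a b c -> calH n a b c},
  forall x : KB K n, g (proj _ (proj _ x)) = proj _ x.
Proof.
have cub x : cubic_ideal n a b c x -> proj (calH_ideal n a b c) x = 0.
  by move=> x0; apply/proj_eq0/calH_idealE; split; apply: cubic_sub_J x0;
    rewrite !inE eqxx ?orbT.
have [h hE] := quot_lift_exists cub.
have hI x : calK_ideal n a b c x -> h x = 0.
  have kerI : two_sided_ideal (fun x => h x = 0).
    split=> [|y z y0 z0|y z z0|y z y0]; first exact: rmorph0.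
    - by rewrite rmorphD y0 z0 addr0.
    - by rewrite rmorphM z0 mulr0.
    - by rewrite rmorphM y0 mul0r.
  apply: (@ideal_gen_min _ _ (Ideal kerI)) => {}x [i [j /= [ie je ->]]].
  rewrite !expr2 [h _](rmorph_relator h) /sHecke !hE -rmorph_relator.
  by apply/proj_eq0/calH_idealE; split; apply: J_relator.
have [g gE] := quot_lift_exists hI.
by exists g => x; rewrite gE hE.
Qed.

Lemma calH_ideal_calK : generic a b c -> forall x : KB K n,
  calH_ideal n a b c x -> proj (calK_ideal n a b c) (proj (cubic_ideal n a b c) x) = 0.
Proof.
move=> [[a0 b0 c0] abc ss3 _] x /calH_idealE[Jab Jac Jbc].
pose pi : {rmorphism KB K n -> calK n a b c} :=
  proj (calK_ideal n a b c) \o proj (cubic_ideal n a b c).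
pose e := letter a b c; pose N := m.+2.
(* [inord] sends indices outside the range to 0; the relations below are restricted to indices less
   than N. *)
pose st j : calK n a b c := pi (@s K n (inord j : 'I_N)).
have e0 i : e i != 0 by case: i => [[|[|[|//]]] ?].
have [ab ac bc] : [/\ a != b, a != c & b != c].
  by move: abc; rewrite !mulf_eq0 !negb_or !subr_eq0 -andbA => /and3P.
have e_inj : injective e.
  move=> i j; rewrite /e /letter.
  by case: i j => [[|[|[|//]]] p] [[|[|[|//]]] q] //= E; try exact: val_inj;
    move: ab ac bc; rewrite E ?eqxx // -?E ?eqxx.
have A_neq0 : 1 <> 0 :> KB K n.
  by rewrite -(scal0 (KB K n)) -scal1 => /scal_galg_inj /eqP; rewrite oner_eq0.
have reg := split_semisimple_regular ss3.
have e_quad i j : i != j -> e i ^+ 2 - e i * e j + e j ^+ 2 != 0.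
  have root l : (e l - a) * (e l - b) * (e l - c) = 0.
    rewrite /e /letter; case: l => [[|[|[|//]]] p] /=;
      by rewrite subrr ?(mulr0, mul0r).
  by move=> _; apply: (regular_quadratic A_neq0 reg (e0 i) (e0 j) (root i) (root j)).
have st_reg i : (i < N)%N -> forall z, st i * z = 0 -> z = 0.
  move=> _ z z0; rewrite -[z]mul1r -(rmorph1 pi) -(@s_mulVl K n (inord i : 'I_N)).
  by rewrite rmorphM -mulrA z0 mulr0.
have st_braid i : (i.+1 < N)%N -> st i * st i.+1 * st i = st i.+1 * st i * st i.+1.
  move=> iN; rewrite -!rmorphM; congr (pi _).
  by apply: s_braid; rewrite !inordK // ltnW.
have st_comm i j : (i.+1 < j < N)%N -> st i * st j = st j * st i.
  move=> /andP[ij jN]; rewrite -!rmorphM; congr (pi _).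
  by apply: s_comm; rewrite !inordK //; lia.
have w_reg i : (i.+1 < N)%N -> forall z, st i.+1 * st i * z = 0 -> z = 0.
  by move=> iN z; rewrite -mulrA => /(st_reg _ iN) /(st_reg _ (ltnW iN)).
have conj i : (i.+1 < N)%N -> st i * (st i.+1 * st i) = st i.+1 * st i * st i.+1.
  by move=> iN; rewrite mulrA st_braid.
(* The cubic relation is imposed on s_1 only; conjugation by [st i.+1 * st i] carries it to the next
   generator. *)
have st_spectral i : (i < N)%N -> spectral e (st i).
  elim: i => [|i IH] iN.
    set s0 := @s K n (inord 0 : 'I_N).
    have : pi ((s0 - scal a) * (s0 - scal b) * (s0 - scal c)) = 0.
      suff cub : proj (cubic_ideal n a b c)
          ((s0 - scal a) * (s0 - scal b) * (s0 - scal c)) = 0.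
        by rewrite /pi /= cub rmorph0.
      by apply/proj_eq0; apply: ideal_gen_sub; exists (inord 0); rewrite ?inordK.
    by rewrite !rmorphM !rmorphB => /spectralP.
  exact: (spectral_conj (w_reg _ iN) (conj _ iN) (IH (ltnW iN))).
have st_linked i : (i.+1 < N)%N -> linked (eigenproj e (st i)) (eigenproj e (st i.+1)).
  elim: i => [|i IH] iN.
    apply: eigenproj_linked; rewrite -[LHS]/(braid_relator (st 0%N) (st 1%N)).
    suff : proj (calK_ideal n a b c) (braid_relator
        (sHecke a b c (inord 0 : 'I_n.-1)) (sHecke a b c (inord 1 : 'I_n.-1))) = 0.
      by rewrite rmorph_relator.
    apply/proj_eq0; apply: ideal_gen_sub; exists (inord 0), (inord 1).
    by rewrite !inordK.
  have iN1 := ltnW iN.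
  (* Conjugation by [w] moves the pair (i, i + 1) to (i + 1, i + 2). *)
  pose w := st i.+2 * st i.+1 * st i.
  have wr z : w * z = 0 -> z = 0.
    by rewrite /w -2!mulrA => /(st_reg _ iN) /(st_reg _ iN1) /(st_reg _ (ltnW iN1)).
  have xw : st i * w = w * st i.+1.
    rewrite /w !mulrA st_comm ?ltnSn //.
    by rewrite -2!mulrA (mulrA (st i)) st_braid // !mulrA.
  have yw : st i.+1 * w = w * st i.+2.
    rewrite /w !mulrA st_braid // -2!mulrA -[st i.+2 * st i]st_comm ?ltnSn //.
    by rewrite !mulrA.
  apply: (linked_conj wr _ _ (IH iN1)) => l; exact: eigenproj_intertwine.
have pi_scal k : pi (scal k) = scal k by [].
have pi_s (i : 'I_N) : pi (@s K n i) = st i by rewrite /st inord_val.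
have JJ i j : i != j -> J n (e i) (e j) x.
  rewrite /e /letter.
  by case: i j => [[|[|[|//]]] p] [[|[|[|//]]] q] //= _; try exact: J_sym.
exact: (pi_eq0 e_inj e0 e_quad st_reg st_spectral st_braid st_comm st_linked
  (ltn0Sn _) pi_scal pi_s JJ).
Qed.

End NaturalMorphism.

Theorem corollary2p14 (K : fieldType) (a b c : K) (n : nat) :
  [pchar K] =i pred0 ->
  generic a b c ->
  (3 <= n)%N ->
  exists f : {rmorphism calK n a b c -> calH n a b c},
    [/\ is_alg_morphism f,
        forall i : 'I_n.-1, f (s_calK a b c i) = s_calH a b c i
      & bijective f].
Proof.
move=> _ gen; case: n => [|[|[|m]]] // _.
have [f fE] := natural_map m a b c.
pose pi : {rmorphism KB K m.+3 -> calK m.+3 a b c} :=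
  proj (calK_ideal m.+3 a b c) \o proj (cubic_ideal m.+3 a b c).
have pi_ker x : calH_ideal m.+3 a b c x -> pi x = 0 by exact: calH_ideal_calK.
(* The inverse of [f]: the projection of [KB] onto [calK] factors through [calH]. *)
have [h hE] := quot_lift_exists pi_ker.
exists f; split=> [k|i|]; [exact: fE | exact: fE |].
exists h => [q|q].
  by have [y ->] := proj_surj q; have [x ->] := proj_surj y; rewrite fE hE.
by have [x ->] := proj_surj q; rewrite hE /= fE.
Qed.
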